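(* Let $l:\Omega_T\times[0,T]\times\mathbb{R}\to\mathbb{R}$ satisfy ($H_l$) and let $S$ satisfy ($H_S$) with exponent $p\ge1$. Suppose in addition that there exist an increasing and continuous function $F:[0,\infty)\to[0,\infty)$ with $F(0)=0$ and two constants $0<c_l<C_l$ such that (1) for any $t,s\in[0,T]$ and $x\in\mathbb{R}$, $|l(t,x)-l(s,x)|\le F(|t-s|)$; (2) for any $t\in[0,T]$ and $x,y\in\mathbb{R}$, $c_l|x-y|\le|l(t,x)-l(t,y)|\le C_l|x-y|$. Then there exists a unique solution $(X,A)\in S_G^p(0,T)\times I[0,T]$ to the Skorokhod problem with mean reflection $\mathbb{SP}(l,S)$.
   Context: **$G$-expectation framework.** Fix $T>0$ and $0<\underline{\sigma}^2<\overline{\sigma}^2$; $\Omega_T$ is the space of real-valued continuous functions on $[0,T]$ starting from $0$, with the supremum norm and Borel $\sigma$-algebra $\mathcal{B}(\Omega_T)$; $B$ is the canonical process; $G(a)=\frac12(\overline{\sigma}^2a^+-\underline{\sigma}^2a^-)$. $L_{ip}(\Omega_T)$ is the set of $\varphi(B_{t_1},\dots,B_{t_n})$ with $n\in\mathbb{N}$, $t_i\in[0,T]$, $\varphi$ bounded Lipschitz on $\mathbb{R}^n$. The $G$-expectation of $\xi=\varphi(B_{t_1},\dots,B_{t_n})$, $0=t_0\le t_1<\dots<t_n$, is $\widehat{\mathbb{E}}[\xi]=u_1(0,0)$, where, backwards in $k$, $u_k(t,x;x_1,\dots,x_{k-1})$ is the (viscosity) solution of $\partial_tu_k+G(\partial_x^2u_k)=0$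 on $[t_{k-1},t_k)\times\mathbb{R}$ with terminal condition $u_n(t_n,x;x_1,\dots,x_{n-1})=\varphi(x_1,\dots,x_{n-1},x)$ and $u_k(t_k,x;x_1,\dots,x_{k-1})=u_{k+1}(t_k,x;x_1,\dots,x_{k-1},x)$ for $k<n$. $L_G^p(\Omega_T)$ ($p\ge1$) is the completion of $L_{ip}(\Omega_T)$ under $\|\xi\|_{L_G^p}=(\widehat{\mathbb{E}}|\xi|^p)^{1/p}$. There is a weakly compact set $\mathcal{P}$ of probability measures on $(\Omega_T,\mathcal{B}(\Omega_T))$ with $\widehat{\mathbb{E}}[\xi]=\sup_{\mathsf{P}\in\mathcal{P}}\mathsf{E}^{\mathsf{P}}[\xi]$ for $\xi\in L_G^1(\Omega_T)$; the same formula defines $\widehat{\mathbb{E}}$ for other measurable random variables. A property holds quasi-surely (q.s.) if it holds outside a set $N$ with $\sup_{\mathsf{P}\in\mathcal{P}}\mathsf{P}(N)=0$; random variables that are equal q.s. are identified, and inequalities between random variables are understood q.s. **Process spaces.** $S_G^0(0,T)$ is the set of processes $f(t,B_{t_1\wedge t},\dots,B_{t_n\wedge t})$ with $t_i\in[0,T]$, $f$ bounded Lipschitz on $\mathbb{R}^{n+1}$; $S_G^p(0,T)$ is its completion under $\|\eta\|_{S_G^p}=(\widehat{\mathbb{E}}\sup_{t\in[0,T]}|\eta_t|^p)^{1/p}$. $I[0,T]$ is the set of deterministic continuous nondecreasing functions on $[0,T]$ with initial value $0$. **Assumptions** (dependence on $\omega$ is suppressed). ($H_l$) $l:\Omega_T\times[0,T]\times\mathbb{R}\to\mathbb{R}$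 satisfies: (1) $l(t,x)$ is uniformly continuous in $(t,x)$, uniformly in $\omega$; (2) for every $t$, $x\mapsto l(t,x)$ is strictly increasing, q.s.; (3) for every $(t,x)$, $l(t,x)\in L_G^1(\Omega_T)$, and $\widehat{\mathbb{E}}[\lim_{x\uparrow\infty}l(t,x)]>0$; (4) for some $\kappa>0$, $|l(t,x)|\le\kappa(1+|x|)$ q.s. for every $(t,x)$. ($H_S$) There exists $p\ge1$ such that $S\in S_G^p(0,T)$, and $\widehat{\mathbb{E}}[l(0,S_0)]\ge0$. **Skorokhod problem with mean reflection.** A solution of $\mathbb{SP}(l,S)$ is a pair $(X,A)\in S_G^p(0,T)\times I[0,T]$ such that for $t\in[0,T]$: (a) $X_t=S_t+A_t$; (b) $\widehat{\mathbb{E}}[l(t,X_t)]\ge0$; (c) $\int_0^T\widehat{\mathbb{E}}[l(t,X_t)]\,dA_t=0$. *)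

(* Defs.v *)
From HB Require Import structures.
From mathcomp Require Import all_boot all_order all_algebra.
From mathcomp Require Import all_classical all_reals all_analysis.
From mathcomp Require Import measurable_realfun.

Set Implicit Arguments.
Unset Strict Implicit.
Unset Printing Implicit Defensive.

Import Order.TTheory GRing.Theory Num.Theory.
Import numFieldNormedType.Exports.

Local Open Scope classical_set_scope.
Local Open Scope ring_scope.

(* A continuous function on [0, T] is encoded by its extension to R that is   *)
(* constant on each side of [0, T]; this makes equality of paths extensional. *)
Definition clamp (R : realType) (T t : R) : R := Num.min (Num.max t 0) T.

Definition frozen (R : realType) (T : R) (f : R -> R) : Prop :=
  forall t, f t = f (clamp T t).

Lemma clamp_itv (R : realType) (T t : R) :
  0 <= T -> clamp T t \in `[0, T].
Proof.
by move=> T0; rewrite in_itv/= /clamp le_min ge_min T0 le_max !lexx !orbT.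
Qed.

Section path_space.
Context {R : realType}.
Variable T : R.

Record cpath : Type := CPath {
  cpath_fun :> R -> R ;
  cpath_continuous : continuous cpath_fun ;
  cpath_frozen : frozen T cpath_fun ;
  cpath0 : cpath_fun 0 = 0 }.

HB.instance Definition _ := gen_eqMixin cpath.
HB.instance Definition _ := gen_choiceMixin cpath.

Lemma cpathP (v w : cpath) : (forall t, v t = w t) -> v = w.
Proof.
case: v w => [f cf ff f0] [g cg fg g0] /= /funext fgE.
move: cf ff f0; rewrite fgE => cf ff f0.
by congr CPath; exact: Prop_irrelevance.
Qed.

Lemma cpath_cst0_frozen : frozen T (fun=> 0 : R).
Proof. by []. Qed.

Definition cpath_zero : cpath := @CPath (fun=> 0) (@cst_continuous _ _ 0)
  cpath_cst0_frozen erefl.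

HB.instance Definition _ := isPointed.Build cpath cpath_zero.

Definition cpath_dist (v w : cpath) : R :=
  sup [set `|v t - w t| | t in `[0, T]%classic].

Lemma cpath_dist_has_ubound (v w : cpath) :
  has_ubound [set `|v t - w t| | t in `[0, T]%classic].
Proof.
have cvw : {within `[0, T], continuous (fun t => `|v t - w t|)}.
  apply: continuous_subspaceT => t.
  apply: (@cvg_norm _ R^o); apply: (@cvgB _ R^o); exact: cpath_continuous.
have [T0|T0] := lerP 0 T; last first.
  exists 0 => _ [t /= + <-]; rewrite in_itv/= => /andP[t0 tT].
  by move: T0; rewrite ltNge (le_trans t0 tT).
have [c _ mc] := EVT_max T0 cvw.
by exists `|v c - w c| => _ [t tT <-]; exact: mc.
Qed.

Lemma cpath_dist_ub (v w : cpath) (t : R) :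
  t \in `[0, T] -> `|v t - w t| <= cpath_dist v w.
Proof.
by move=> tT; apply: ub_le_sup; [exact: cpath_dist_has_ubound|exists t].
Qed.

Lemma cpath_dist_le (v w : cpath) (e : R) : 0 <= e ->
  (forall t, t \in `[0, T] -> `|v t - w t| <= e) -> cpath_dist v w <= e.
Proof.
move=> e0 h; rewrite /cpath_dist; have [T0|T0] := lerP 0 T.
  apply: ge_sup; first by exists `|v 0 - w 0|, 0 => //=; rewrite in_itv/= lexx.
  by move=> _ [t tT <-]; exact: h.
rewrite (_ : [set _ | _ in _] = set0) ?sup0//.
apply/seteqP; split => // x [t /= + _]; rewrite in_itv/= => /andP[t0 tT].
by move: T0; rewrite ltNge (le_trans t0 tT).
Qed.

Lemma cpath_dist_ge0 (v w : cpath) : 0 <= cpath_dist v w.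
Proof.
have [T0|T0] := lerP 0 T.
  by rewrite (le_trans (normr_ge0 (v 0 - w 0)))// cpath_dist_ub// in_itv/= lexx.
rewrite /cpath_dist (_ : [set _ | _ in _] = set0) ?sup0//.
apply/seteqP; split => // x [t /= + _]; rewrite in_itv/= => /andP[t0 tT].
by move: T0; rewrite ltNge (le_trans t0 tT).
Qed.

Lemma cpath_distxx (v : cpath) : cpath_dist v v = 0.
Proof.
apply/eqP; rewrite eq_le cpath_dist_ge0 andbT cpath_dist_le// => t _.
by rewrite subrr normr0.
Qed.

Lemma cpath_dist_positivity (v w : cpath) : cpath_dist v w = 0 -> v = w.
Proof.
move=> vw0; apply: cpathP => t.
have [T0|T0] := lerP 0 T.
  rewrite (cpath_frozen v) (cpath_frozen w); apply/eqP; rewrite -subr_eq0.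
  rewrite -normr_eq0 eq_le normr_ge0 andbT -vw0 cpath_dist_ub//.
  exact: clamp_itv.
have cst (u : cpath) : u t = 0.
  rewrite -(cpath0 u) (cpath_frozen u t) (cpath_frozen u 0).
  by congr (u _); rewrite /clamp maxxx !min_r// ?(ltW T0)// le_max (ltW T0) orbT.
by rewrite !cst.
Qed.

Lemma cpath_dist_sym (v w : cpath) : cpath_dist v w = cpath_dist w v.
Proof.
by rewrite /cpath_dist; congr sup; apply: eq_imagel => t _; rewrite distrC.
Qed.

Lemma cpath_dist_triangle (u v w : cpath) :
  cpath_dist v w <= cpath_dist v u + cpath_dist u w.
Proof.
apply: cpath_dist_le => [|t tT]; first by rewrite addr_ge0 ?cpath_dist_ge0.
by rewrite (le_trans (ler_distD (u t) _ _))// lerD ?cpath_dist_ub.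
Qed.

HB.instance Definition _ := isMetric.Build R cpath
  cpath_distxx cpath_dist_positivity cpath_dist_sym cpath_dist_triangle.

HB.instance Definition _ :=
  Measurable.copy cpath (g_sigma_algebraType (@open cpath)).

End path_space.

Section deterministic_increasing.
Context {R : realType}.
Variable T : R.

Record incr_fun : Type := IncrFun {
  incr_fun_val :> R -> R ;
  incr_fun_continuous : continuous incr_fun_val ;
  incr_fun_frozen : frozen T incr_fun_val ;
  incr_fun_nd : nondecreasing incr_fun_val ;
  incr_fun0 : incr_fun_val 0 = 0 }.

HB.instance Definition _ (A : incr_fun) := isCumulative.Build R _ R
  (incr_fun_val A) (@incr_fun_nd A)
  (right_continuousW (@incr_fun_continuous A)).

End deterministic_increasing.

Definition bounded_lipschitz (R : realType) (n : nat) (f : 'rV[R]_n -> R) :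
  Prop := (exists M : R, forall x, `|f x| <= M) /\
          (exists k : R, k.-lipschitz f).

Section G_expectation.
Context {R : realType}.
Variables (sigl sigu : R).

Definition Gfun (a : R) : R :=
  (sigu ^+ 2 * Num.max a 0 - sigl ^+ 2 * Num.max (- a) 0) / 2.

(* C^{1,2}: once differentiable in time t, twice in space x *)
Definition C12 (h : R -> R -> R) : Prop :=
  [/\ forall t x, derivable (h ^~ x) t 1,
      forall t x, derivable (h t) x 1 /\ derivable (derive1 (h t)) x 1 &
      [/\ continuous (fun z : R * R => h z.1 z.2),
          continuous (fun z : R * R => derive1 (h ^~ z.2) z.1),
          continuous (fun z : R * R => derive1 (h z.1) z.2) &
          continuous (fun z : R * R => derive1 (derive1 (h z.1)) z.2)]].

Definition viscosity_subsolution (s t : R) (u : R -> R -> R) : Prop :=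
  forall (h : R -> R -> R) (r y : R), C12 h -> s <= r < t ->
    u r y = h r y ->
    (forall r' y', s <= r' < t -> u r' y' <= h r' y') ->
    0 <= derive1 (h ^~ y) r + Gfun (derive1 (derive1 (h r)) y).

Definition viscosity_supersolution (s t : R) (u : R -> R -> R) : Prop :=
  forall (h : R -> R -> R) (r y : R), C12 h -> s <= r < t ->
    u r y = h r y ->
    (forall r' y', s <= r' < t -> h r' y' <= u r' y') ->
    derive1 (h ^~ y) r + Gfun (derive1 (derive1 (h r)) y) <= 0.

(* Viscosity solutions are unique only within a growth class: we take bounded *)
(* continuous functions on [s, t] x R, as the data psi are bounded Lipschitz. *)
(* When s = t only the terminal condition remains.                            *)
Definition Gheat_solution (s t : R) (psi : R -> R) (u : R -> R -> R) : Prop :=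
  [/\ {within [set z : R * R | s <= z.1 <= t],
         continuous (fun z => u z.1 z.2)},
      exists M : R, forall r y, s <= r <= t -> `|u r y| <= M,
      viscosity_subsolution s t u /\ viscosity_supersolution s t u &
      forall y, u t y = psi y].

(* [u xs] is the function u_k(., .; x_1, ..., x_(k-1)) of the backward        *)
(* recursion, with xs = [:: x_1; ...; x_(k-1)], hence k = (size xs).+1.       *)
Definition G_recursion (n : nat) (t : nat -> R) (phi : 'rV[R]_n -> R)
    (u : seq R -> R -> R -> R) : Prop :=
  forall xs : seq R, (size xs < n)%N ->
    let k := (size xs).+1 in
    Gheat_solution (t k.-1) (t k)
      (fun y => if k == n then phi (\row_(i < n) nth 0 (rcons xs y) i)
                else u (rcons xs y) (t k) y)
      (u xs).

Variable T : R.

(* [G_expectation xi v] : v is the G-expectation of the random variable xi in *)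
(* Lip(Omega_T), computed from some representation of xi along a time grid.   *)
Definition G_expectation (xi : cpath T -> R) (v : R) : Prop :=
  exists (n : nat) (t : nat -> R) (phi : 'rV[R]_n -> R)
         (u : seq R -> R -> R -> R),
    [/\ (0 < n)%N,
        [/\ t 0%N = 0, 0 <= t 1%N,
            forall k, (0 < k < n)%N -> t k < t k.+1 & t n <= T],
        bounded_lipschitz phi /\
          (forall w : cpath T, xi w = phi (\row_(i < n) w (t i.+1))),
        G_recursion t phi u &
        v = u [::] 0 0].

End G_expectation.

Section upper_expectation.
Context {R : realType}.
Variable T : R.

Definition bounded_continuous : Type :=
  {f : cpath T -> R | continuous f /\ exists M : R, forall w, `|f w| <= M}.

(* The initial topology of weak_eval is the topology of weak convergence.     *)
Definition weak_eval (P : probability (cpath T) R) :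
    {ptws bounded_continuous -> R} :=
  fun f => \int[P]_w (sval f w).

Definition weakly_compact (calP : set (probability (cpath T) R)) : Prop :=
  compact (calP : set (initial_topology weak_eval)).

Variable calP : set (probability (cpath T) R).

Definition Ehat (f : cpath T -> \bar R) : \bar R :=
  ereal_sup [set (\int[P]_w f w)%E | P in calP].

Definition polar (N : set (cpath T)) : Prop :=
  measurable N /\ ereal_sup [set P N | P in calP] = 0%E.

Definition qs (Q : cpath T -> Prop) : Prop :=
  exists2 N, polar N & forall w, ~ N w -> Q w.

(* Random variables are identified when they are equal q.s., so that the      *)
(* measurability requirement bears on classes modulo q.s. equality.           *)
Definition qs_measurable (f : cpath T -> \bar R) : Prop :=
  exists2 g : cpath T -> \bar R, measurable_fun setT g & qs (fun w => f w = g w).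

Definition Lip : set (cpath T -> R) :=
  [set xi | exists (n : nat) (t : 'I_n -> R) (phi : 'rV[R]_n -> R),
    [/\ forall i, t i \in `[0, T], bounded_lipschitz phi &
        forall w : cpath T, xi w = phi (\row_(i < n) w (t i))]].

Definition LG_norm (p : R) (xi : cpath T -> R) : \bar R :=
  (Ehat (fun w => (`|xi w| `^ p)%:E) `^ p^-1)%E.

(* The completion of Lip, realised inside the space of random variables. *)
Definition LG (p : R) : set (cpath T -> R) :=
  [set xi | qs_measurable (EFin \o xi) /\
    exists2 xi_ : nat -> cpath T -> R, (forall n, Lip (xi_ n)) &
      LG_norm p (fun w => xi_ n w - xi w) @[n --> \oo] --> 0%E].

(* A process is a map R -> cpath T -> R, of which only the restriction to     *)
(* times in [0, T] is relevant.                                               *)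
Definition SG0 : set (R -> cpath T -> R) :=
  [set eta | exists (n : nat) (t : 'I_n -> R) (f : 'rV[R]_(1 + n) -> R),
    [/\ forall i, t i \in `[0, T], bounded_lipschitz f &
        forall (s : R) (w : cpath T), s \in `[0, T] ->
          eta s w = f (row_mx (const_mx s)
                              (\row_(i < n) w (Num.min (t i) s)))]].

Definition sup_pow (p : R) (eta : R -> cpath T -> R) (w : cpath T) : \bar R :=
  ereal_sup [set (`|eta t w| `^ p)%:E | t in `[0, T]%classic].

Definition SG_norm (p : R) (eta : R -> cpath T -> R) : \bar R :=
  (Ehat (sup_pow p eta) `^ p^-1)%E.

(* The completion of SG0, realised inside the space of processes. *)
Definition SG (p : R) : set (R -> cpath T -> R) :=
  [set eta | (forall t : R, t \in `[0, T] -> qs_measurable (EFin \o eta t)) /\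
    exists2 eta_ : nat -> R -> cpath T -> R, (forall n, SG0 (eta_ n)) &
      (forall n, qs_measurable (sup_pow p (fun t w => eta_ n t w - eta t w))) /\
      SG_norm p (fun t w => eta_ n t w - eta t w) @[n --> \oo] --> 0%E].

End upper_expectation.

(* It suffices to represent the G-expectation on Lip: both sides of the       *)
(* identity extend by continuity to LG 1.                                     *)
Definition G_representing (R : realType) (sigl sigu T : R)
    (calP : set (probability (cpath T) R)) : Prop :=
  weakly_compact calP /\
  forall (xi : cpath T -> R) (v : R), G_expectation sigl sigu xi v ->
    Ehat calP (fun w => (xi w)%:E) = v%:E.

Section mean_reflection.
Context {R : realType}.
Variables (T : R) (calP : set (probability (cpath T) R)).
Variable l : cpath T -> R -> R -> R.

Definition Hl : Prop :=
  [/\ forall e : R, 0 < e -> exists2 d : R, 0 < d &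
        forall w (t s x y : R), t \in `[0, T] -> s \in `[0, T] ->
          `|t - s| < d -> `|x - y| < d -> `|l w t x - l w s y| < e,
      forall t : R, t \in `[0, T] ->
        qs calP (fun w => forall x y, x < y -> l w t x < l w t y),
      forall t : R, t \in `[0, T] ->
        (forall x, LG calP 1 (fun w => l w t x)) /\
        (0 < Ehat calP (fun w => lim ((l w t x)%:E @[x --> +oo%R])))%E &
      exists2 kappa : R, 0 < kappa &
        forall t x : R, t \in `[0, T] ->
          qs calP (fun w => `|l w t x| <= kappa * (1 + `|x|))].

Definition HS (p : R) (S : R -> cpath T -> R) : Prop :=
  [/\ 1 <= p, SG calP p S & (0 <= Ehat calP (fun w => (l w 0 (S 0 w))%:E))%E].

Definition SP_solution (p : R) (S X : R -> cpath T -> R) (A : incr_fun T) :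
    Prop :=
  [/\ SG calP p X,
      forall t : R, t \in `[0, T] -> qs calP (fun w => X t w = S t w + A t),
      forall t : R, t \in `[0, T] ->
        (0 <= Ehat calP (fun w => (l w t (X t w))%:E))%E &
      (\int[lebesgue_stieltjes_measure (A : cumulative R R)]_(t in `[0%R, T])
          Ehat calP (fun w => (l w t (X t w))%:E) = 0)%E].

End mean_reflection.

(* Main.v *)
Require Import Defs.
From mathcomp Require Import all_boot all_order all_algebra.
From mathcomp Require Import all_classical all_reals all_analysis.
From mathcomp Require Import measurable_realfun.
From mathcomp Require Import lra.

Set Implicit Arguments.
Unset Strict Implicit.
Unset Printing Implicit Defensive.

Import Order.TTheory GRing.Theory Num.Theory.
Import numFieldNormedType.Exports.

Local Open Scope classical_set_scope.
Local Open Scope ring_scope.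

(* Put phi t x = E[l(t, S_t + x)].  By sublinearity of the G-expectation, phi  *)
(* is bi-Lipschitz and increasing in x, and it is continuous in t because      *)
(* t |-> S_t is continuous for E|.|: for simple processes this is Dini's       *)
(* theorem on the weakly compact set calP, applied to the moduli of continuity *)
(* of the paths.  Hence phi t has a unique zero a_t, which is continuous in t, *)
(* and the constraint E[l(t, S_t + A_t)] >= 0 reads A_t >= a_t.  The solution  *)
(* is the running maximum A_t = sup_(s <= t) a_s^+: it is locally constant on  *)
(* {a < A}, which is therefore a null set for dA.  Any other solution A'       *)
(* satisfies A' >= A; if A'_t > A_t, let r be the last time before t at which  *)
(* A' - A is at most half of its value at t.  On ]r, t] the mean loss is       *)
(* bounded away from 0, so A' is constant there, and A' - A cannot have        *)
(* increased from r to t.                                                      *)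

(** The problem reduces to a deterministic obstacle problem. If [X = S + A] q.s., the mean loss at
    time [t] is [mean_loss t (A t)], and its unique zero [a t] is the obstacle that [A] has to stay
    above. [mean_loss_bilipschitz] and [mean_loss_ucont] yield a uniformly continuous obstacle
    ([mean_loss_root]). Its running maximum solves the problem: [runmax_flat] and [flat_null] show
    that [A] grows only where it touches [a]. Conversely, [stieltjes_integral_eq0_flat] forbids any
    growth of a solution while it is away from [a], which gives uniqueness.

    The probabilistic work consists of three points. (i) The hypotheses hold q.s. for one time or
    one pair of arguments, with an exceptional set depending on them; countable unions and
    continuity give a single exceptional set, in [loss_bilipschitz] for the loss and in
    [SG_itv_ucont] for the paths. (ii) [SG_Eup_ucont], continuity in mean, comes from
    [weakly_compact_dini] for simple processes and passes to the completion. (iii) [SG_add_incr_fun]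
    keeps [S + A] in the completion, through uniform approximation of [A] by Lipschitz functions. *)

Section integral_modulo_null_sets.
Local Open Scope ereal_scope.
Context d (X : measurableType d) (R : realType).
Variable mu : {measure set X -> \bar R}.

Import HBNNSimple.

(** Valid for arbitrary, possibly non-measurable [f] and [g]: the integral of a nonnegative function
    is a supremum over the simple functions below it, and a simple function below [f] can be cut to
    0 on [N], which keeps its integral and puts it below [g]. This fits random variables that are
    measurable only up to q.s. equality. *)
Lemma ge0_null_le_integral (N : set X) (f g : X -> \bar R) :
  measurable N -> mu N = 0 -> (forall x, 0 <= f x) -> (forall x, 0 <= g x) ->
  (forall x, ~ N x -> f x <= g x) -> \int[mu]_x f x <= \int[mu]_x g x.
Proof.
move=> mN N0 f0 g0 fg; rewrite ge0_integralTE// ge0_integralTE//.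
apply: ge_ereal_sup => _ [h /= hf <-].
pose k : {nnsfun X >-> R} := mul_nnsfun h (indic_nnsfun R (measurableC mN)).
have kE x : k x = (h x * \1_(~` N) x)%R by [].
have -> : sintegral mu h = sintegral mu k.
  transitivity (\int[mu]_x (h x)%:E).
    by rewrite integral_nnsfun// patch_setT.
  transitivity (\int[mu]_x (k x)%:E); last first.
    by rewrite integral_nnsfun// patch_setT.
  apply: ge0_ae_eq_integral => //.
  - exact/measurable_EFinP.
  - exact/measurable_EFinP.
  - by move=> x _; rewrite lee_fin.
  - by move=> x _; rewrite lee_fin.
  exists N; split => // x /= Nhk; apply: contrapT => Nx; apply: Nhk => _ /=.
  by rewrite -[(_ * _)%R]/(k x) kE indicE mem_set// mulr1.
apply: ereal_sup_ubound; exists k => // x.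
have [Nx|Nx] := pselect (N x).
  by rewrite kE indicE memNset ?mulr0//=; apply.
by rewrite kE indicE mem_set// mulr1 (le_trans (hf x))// fg.
Qed.

Lemma null_eq_integral (N : set X) (f g : X -> \bar R) :
  measurable N -> mu N = 0 -> (forall x, ~ N x -> f x = g x) ->
  \int[mu]_x f x = \int[mu]_x g x.
Proof.
move=> mN N0 fg; rewrite integralE [RHS]integralE; congr (_ - _).
  by apply/eqP; rewrite eq_le; apply/andP; split;
    apply: ge0_null_le_integral mN N0 _ _ _ => // x Nx; rewrite !funeposE fg.
by apply/eqP; rewrite eq_le; apply/andP; split;
  apply: ge0_null_le_integral mN N0 _ _ _ => // x Nx; rewrite !funenegE fg.
Qed.

End integral_modulo_null_sets.

(** * Polar sets and the upper expectation *)

Section quasi_sure.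
Context {R : realType} {T : R}.
Variable calP : set (probability (cpath T) R).
Implicit Types (N : set (cpath T)) (Q : cpath T -> Prop).

Lemma probability_integral_cst (P : probability (cpath T) R) (r : R) :
  (\int[P]__ r%:E = r%:E)%E.
Proof. by rewrite integral_cst// [X in (_ * X)%E]probability_setT mule1. Qed.

Lemma qsW Q Q' : (forall w, Q w -> Q' w) -> qs calP Q -> qs calP Q'.
Proof. by move=> QQ' [N pN NQ]; exists N => // w /NQ /QQ'. Qed.

Hypothesis calP0 : calP !=set0.

(** From right to left [calP] must be nonempty, since the supremum of an empty family is [-oo] and
    not 0. *)
Lemma polarP N : polar calP N <->
  measurable N /\ forall P, calP P -> P N = 0%E.
Proof.
split=> [[mN N0]|[mN N0]]; split=> //.
  move=> P PP; apply/eqP; rewrite eq_le measure_ge0 andbT -N0.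
  by apply: ereal_sup_ubound; exists P.
apply/eqP; rewrite eq_le; apply/andP; split.
  by apply: ge_ereal_sup => _ [P PP <-]; rewrite N0.
by have [P PP] := calP0; apply: ereal_sup_ubound; exists P => //; exact: N0.
Qed.

Lemma polar_bigcup (N_ : nat -> set (cpath T)) :
  (forall n, polar calP (N_ n)) -> polar calP (\bigcup_n N_ n).
Proof.
move=> N_0; apply/polarP; split.
  by apply: bigcup_measurable => n _; have /polarP[] := N_0 n.
move=> P PP; apply/measure_negligible.
  by apply: bigcup_measurable => n _; have /polarP[] := N_0 n.
apply: negligible_bigcup => n; have /polarP[mN N0] := N_0 n.
by exists (N_ n); split => //; exact: N0.
Qed.

Lemma qs_forall_nat (Q : nat -> cpath T -> Prop) :
  (forall n, qs calP (Q n)) -> qs calP (fun w => forall n, Q n w).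
Proof.
move=> Qn.
have /choice[N_ N_Q] : forall n, exists N,
    polar calP N /\ forall w, ~ N w -> Q n w.
  by move=> n; have [N pN NQ] := Qn n; exists N.
exists (\bigcup_n N_ n); first by apply: polar_bigcup => n; have [] := N_Q n.
move=> w nw n; have [_] := N_Q n; apply => Nnw; apply: nw.
by exists n.
Qed.

(** Exceptional sets depend on the parameter, and only countably many of them can be joined.
    Quantifiers over all times or all reals are reached later from rationals by continuity. *)
Lemma qs_forall (I : countType) (Q : I -> cpath T -> Prop) :
  (forall i, qs calP (Q i)) -> qs calP (fun w => forall i, Q i w).
Proof.
move=> Qi.
have : qs calP (fun w => forall n, if unpickle n is Some i then Q i w else True).
  apply: qs_forall_nat => n; case: (unpickle n) => [i//|].
  by exists set0 => //; apply/polarP; split => // P _; rewrite measure0.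
by apply: qsW => w Qw i; have := Qw (pickle i); rewrite pickleK.
Qed.

Lemma qsT Q : (forall w, Q w) -> qs calP Q.
Proof.
by exists set0 => //; apply/polarP; split => // P _; rewrite measure0.
Qed.

Lemma qs_and Q Q' :
  qs calP Q -> qs calP Q' -> qs calP (fun w => Q w /\ Q' w).
Proof.
move=> hQ hQ'.
have : qs calP (fun w => forall b : bool, if b then Q w else Q' w).
  by apply: qs_forall => -[].
by apply: qsW => w h; split; [exact: (h true)|exact: (h false)].
Qed.

Lemma qs_integral (P : probability (cpath T) R) (f g : cpath T -> \bar R) :
  calP P -> qs calP (fun w => f w = g w) ->
  (\int[P]_w f w = \int[P]_w g w)%E.
Proof.
move=> PP [N /polarP[mN N0] fg]; apply: null_eq_integral mN _ fg.
exact: N0.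
Qed.

Lemma ge0_qs_le_integral (P : probability (cpath T) R)
    (f g : cpath T -> \bar R) : calP P ->
  (forall w, 0 <= f w)%E -> (forall w, 0 <= g w)%E ->
  qs calP (fun w => f w <= g w)%E -> (\int[P]_w f w <= \int[P]_w g w)%E.
Proof.
move=> PP f0 g0 [N /polarP[mN N0] fg].
by apply: ge0_null_le_integral mN _ f0 g0 fg; exact: N0.
Qed.

Lemma Ehat_ub (P : probability (cpath T) R) (f : cpath T -> \bar R) :
  calP P -> (\int[P]_w f w <= Ehat calP f)%E.
Proof. by move=> PP; apply: ereal_sup_ubound; exists P. Qed.

Lemma Ehat_le (f : cpath T -> \bar R) (c : \bar R) :
  (forall P, calP P -> \int[P]_w f w <= c)%E -> (Ehat calP f <= c)%E.
Proof. by move=> h; apply: ge_ereal_sup => _ [P PP <-]; exact: h. Qed.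

Lemma Ehat_ge0 (f : cpath T -> \bar R) :
  (forall w, 0 <= f w)%E -> (0 <= Ehat calP f)%E.
Proof.
move=> f0; have [P PP] := calP0.
by rewrite (le_trans _ (Ehat_ub _ PP))// integral_ge0.
Qed.

Lemma qs_eq_Ehat (f g : cpath T -> \bar R) :
  qs calP (fun w => f w = g w) -> Ehat calP f = Ehat calP g.
Proof.
move=> fg; congr ereal_sup; apply: eq_imagel => P PP; exact: qs_integral.
Qed.

Lemma ge0_Ehat_le (f g : cpath T -> \bar R) :
  (forall w, 0 <= f w)%E -> (forall w, 0 <= g w)%E ->
  qs calP (fun w => f w <= g w)%E -> (Ehat calP f <= Ehat calP g)%E.
Proof.
move=> f0 g0 fg; apply: Ehat_le => P PP.
by rewrite (le_trans _ (Ehat_ub _ PP))//; exact: ge0_qs_le_integral.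
Qed.

Lemma ge0_Ehat_affine (g : cpath T -> \bar R) (a b : R) :
  0 <= a -> 0 <= b -> (forall w, 0 <= g w)%E -> qs_measurable calP g ->
  (Ehat calP (fun w => a%:E * g w + b%:E) <= a%:E * Ehat calP g + b%:E)%E.
Proof.
move=> a0 b0 g0 [h mh gh]; apply: Ehat_le => P PP.
(* [h] is nonnegative only q.s.; its positive part is a version of [g] that is nonnegative
   everywhere, as additivity of the integral demands. *)
pose k := (h^\+)%E.
have gk : qs calP (fun w => g w = k w).
  apply: qsW gh => w gh; rewrite /k funeposE -gh.
  by apply/esym/max_idPl.
have mk : measurable_fun setT k by exact: measurable_funepos.
have k0 w : (0 <= k w)%E by exact: funepos_ge0.
rewrite (@qs_integral P _ (fun w => a%:E * k w + b%:E)%E)//; last first.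
  by apply: qsW gk => w ->.
rewrite ge0_integralD//; last 2 first.
  - by move=> w _; rewrite mule_ge0.
  - exact: emeasurable_funM.
rewrite ge0_integralZl ?lee_fin//.
rewrite probability_integral_cst leeD2r// lee_wpmul2l ?lee_fin//.
by rewrite -(qs_integral PP gk) Ehat_ub.
Qed.

End quasi_sure.

(** * The sublinear expectation on uniformly integrated random variables *)

Section upper_integrable.
Context {R : realType} {T : R}.
Variable calP : set (probability (cpath T) R).
Hypothesis calP0 : calP !=set0.
Implicit Types f g h : cpath T -> R.

Definition qs_measurable_real f := exists2 g : cpath T -> R,
  measurable_fun setT g & qs calP (fun w => f w = g w).

Lemma qs_measurableP f :
  qs_measurable calP (EFin \o f) <-> qs_measurable_real f.
Proof.
split=> [[g mg fg]|[g mg fg]].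
  exists (fine \o g); first exact: measurableT_comp (fine_measurable _) mg.
  by apply: qsW fg => w /= <-.
exists (EFin \o g); first exact/measurable_EFinP.
by apply: qsW fg => w /= ->.
Qed.

Lemma qs_measurable_realD f g : qs_measurable_real f -> qs_measurable_real g ->
  qs_measurable_real (fun w => f w + g w).
Proof.
move=> [f' mf ff'] [g' mg gg']; exists (f' \+ g'); first exact: measurable_funD.
by apply: qsW (qs_and calP0 ff' gg') => w [/= -> ->].
Qed.

Lemma qs_measurable_realN f : qs_measurable_real f ->
  qs_measurable_real (fun w => - f w).
Proof.
move=> [f' mf ff']; exists (fun w => - f' w); first exact: measurableT_comp.
by apply: qsW ff' => w /= ->.
Qed.

Lemma qs_measurable_real_norm f : qs_measurable_real f ->
  qs_measurable_real (fun w => `|f w|).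
Proof.
move=> [f' mf ff']; exists (fun w => `|f' w|); first exact: measurableT_comp.
by apply: qsW ff' => w /= ->.
Qed.

Lemma measurable_qs f : measurable_fun setT f -> qs_measurable_real f.
Proof. by move=> mf; exists f => //; exact: qsT. Qed.

Lemma qs_eq_integral P f g : calP P -> qs calP (fun w => f w = g w) ->
  (\int[P]_w (f w)%:E = \int[P]_w (g w)%:E)%E.
Proof.
by move=> PP fg; apply: (qs_integral calP0 PP); apply: qsW fg => w ->.
Qed.

Lemma qs_eq_integral_norm P f g : calP P -> qs calP (fun w => f w = g w) ->
  (\int[P]_w `|f w|%:E = \int[P]_w `|g w|%:E)%E.
Proof.
by move=> PP fg; apply: (qs_integral calP0 PP); apply: qsW fg => w ->.
Qed.

(** A first moment bounded uniformly over [calP]: on this class [Ehat] is finite, and [Eup] is its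
    real value ([EupE]). *)
Definition upper_integrable f := qs_measurable_real f /\
  exists M : R, forall P, calP P -> (\int[P]_w `|f w|%:E <= M%:E)%E.

Definition Eup f : R := fine (Ehat calP (fun w => (f w)%:E)).

Lemma upper_integrable_version f : upper_integrable f ->
  exists2 g : cpath T -> R, qs calP (fun w => f w = g w) &
    forall P, calP P -> P.-integrable setT (fun w => (g w)%:E).
Proof.
move=> [[g mg fg] [M fM]]; exists g => // P PP; apply/integrableP; split.
  exact/measurable_EFinP.
rewrite (@le_lt_trans _ _ M%:E) ?ltry// (le_trans _ (fM P PP))//.
by rewrite (qs_eq_integral_norm PP fg).
Qed.

Lemma EupE f : upper_integrable f ->
  Ehat calP (fun w => (f w)%:E) = (Eup f)%:E.
Proof.
move=> uf; have [g fg ig] := upper_integrable_version uf.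
have [M fM] := uf.2.
have bM P : calP P -> (`| \int[P]_w (f w)%:E | <= M%:E)%E.
  move=> PP; rewrite (qs_eq_integral PP fg) (le_trans (le_abse_integral _ _ _))//.
    by have /integrableP[] := ig P PP.
  by rewrite (le_trans _ (fM P PP))// (qs_eq_integral_norm PP fg).
rewrite /Eup fineK// fin_real//; apply/andP; split; last first.
  rewrite (@le_lt_trans _ _ M%:E) ?ltry//; apply: Ehat_le => P PP.
  by rewrite (le_trans (lee_abs _))// bM.
have [P PP] := calP0; rewrite (@lt_le_trans _ _ (- M)%:E) ?ltNyr//.
rewrite (le_trans _ (Ehat_ub _ PP))//.
by rewrite EFinN leeNl (le_trans _ (bM P PP))// -abseN lee_abs.
Qed.

(** Monotonicity and subadditivity in one statement; the later comparisons of mean losses go through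
    it, often with a constant for [h]. *)
Lemma Eup_le_add f g h :
  upper_integrable f -> upper_integrable g -> upper_integrable h ->
  qs calP (fun w => f w <= g w + h w) -> Eup f <= Eup g + Eup h.
Proof.
move=> uf ug uh fgh; rewrite -lee_fin EFinD -!EupE//; apply: Ehat_le => P PP.
have [f' ff' jf] := upper_integrable_version uf.
have [g' gg' jg] := upper_integrable_version ug.
have [h' hh' jh] := upper_integrable_version uh.
apply: (@le_trans _ _ (\int[P]_w (g w)%:E + \int[P]_w (h w)%:E)%E); last first.
  by apply: leeD; exact: Ehat_ub.
have mf' : measurable_fun setT f'.
  by have /integrableP[/measurable_EFinP] := jf P PP.
have mg' : measurable_fun setT g'.
  by have /integrableP[/measurable_EFinP] := jg P PP.
have mh' : measurable_fun setT h'.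
  by have /integrableP[/measurable_EFinP] := jh P PP.
(* [f' <= g' + h'] holds only q.s., whereas [le_integral] compares everywhere; the capped function
   is another version of [f] for which the bound holds everywhere. *)
pose k w := Num.min (f' w) (g' w + h' w).
have fk : qs calP (fun w => f w = k w).
  apply: qsW (qs_and calP0 (qs_and calP0 ff' gg') (qs_and calP0 hh' fgh)).
  by move=> w [[fE gE] [hE +]]; rewrite /k fE gE hE => /min_idPl ->.
have mk : measurable_fun setT k.
  by apply: measurable_minr => //; exact: measurable_funD.
have jk : P.-integrable setT (fun w => (k w)%:E).
  apply/integrableP; split; first exact/measurable_EFinP.
  have /integrableP[_] := jf P PP; apply: le_lt_trans.
  by rewrite -(qs_eq_integral_norm PP fk) (qs_eq_integral_norm PP ff').
rewrite (qs_eq_integral PP fk) (qs_eq_integral PP gg') (qs_eq_integral PP hh').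
rewrite -integralD//; [|exact: jg|exact: jh]; apply: le_integral => //.
  by apply: integrableD => //; [exact: jg|exact: jh].
by move=> w _; rewrite -EFinD lee_fin /k ge_min lexx orbT.
Qed.

Lemma upper_integrable_le f g : qs_measurable_real f -> upper_integrable g ->
  qs calP (fun w => `|f w| <= g w) -> upper_integrable f.
Proof.
move=> mf [mg [M gM]] fg; split=> //; exists M => P PP.
rewrite (le_trans _ (gM P PP))//; apply: (ge0_qs_le_integral calP0 PP) => //.
by apply: qsW fg => w fg; rewrite lee_fin (le_trans fg)// ler_norm.
Qed.

Lemma upper_integrable_cst (c : R) : upper_integrable (fun=> c).
Proof.
split; first by apply: measurable_qs.
by exists `|c| => P PP; rewrite probability_integral_cst.
Qed.

Lemma upper_integrableD f g : upper_integrable f -> upper_integrable g ->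
  upper_integrable (fun w => f w + g w).
Proof.
move=> [mf [M fM]] [mg [N gN]]; split; first exact: qs_measurable_realD.
exists (M + N) => P PP; rewrite EFinD.
rewrite (le_trans _ (leeD (fM P PP) (gN P PP)))//.
have [f' mf' ff'] := mf; have [g' mg' gg'] := mg.
rewrite (qs_eq_integral_norm PP ff') (qs_eq_integral_norm PP gg').
rewrite -ge0_integralD//; last 2 first.
- by apply/measurable_EFinP; exact: measurableT_comp.
- by apply/measurable_EFinP; exact: measurableT_comp.
apply: (ge0_qs_le_integral calP0 PP) => //.
  by move=> w; rewrite -EFinD lee_fin addr_ge0.
apply: qsW (qs_and calP0 ff' gg') => w [-> ->].
by rewrite -EFinD lee_fin ler_normD.
Qed.

Lemma upper_integrable_norm f : upper_integrable f ->
  upper_integrable (fun w => `|f w|).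
Proof.
move=> [mf [M fM]]; split; first exact: qs_measurable_real_norm.
by exists M => P PP; under eq_integral do rewrite normr_id; exact: fM.
Qed.

Lemma upper_integrableZ (c : R) f : upper_integrable f ->
  upper_integrable (fun w => c * f w).
Proof.
move=> [[f' mf' ff'] [M fM]].
have mcf : measurable_fun setT (fun w => c * f' w) by exact: measurable_funM.
split; first by exists (fun w => c * f' w) => //; apply: qsW ff' => w ->.
exists (`|c| * M) => P PP.
rewrite (qs_integral calP0 PP (g := fun w => (`|c|%:E * `|f' w|%:E)%E)).
  rewrite ge0_integralZl//; last first.
    by apply/measurable_EFinP; exact: measurableT_comp.
  rewrite EFinM lee_wpmul2l// (le_trans _ (fM P PP))//.
  by rewrite (qs_eq_integral_norm PP ff').
by apply: qsW ff' => w ->; rewrite normrM EFinM.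
Qed.

Lemma Eup_cst (c : R) : Eup (fun=> c) = c.
Proof.
apply: EFin_inj; rewrite -EupE; last exact: upper_integrable_cst.
apply/eqP; rewrite eq_le; apply/andP; split.
  by apply: Ehat_le => P PP; rewrite probability_integral_cst.
have [P PP] := calP0.
by rewrite (le_trans _ (Ehat_ub _ PP))// probability_integral_cst.
Qed.

Lemma ge0_Eup_le_affine (g : cpath T -> \bar R) f (a b e : R) :
  0 <= a -> 0 <= b -> (forall w, 0 <= f w) -> (forall w, 0 <= g w)%E ->
  qs_measurable calP g -> (Ehat calP g <= e%:E)%E ->
  qs calP (fun w => (f w)%:E <= a%:E * g w + b%:E)%E -> Eup f <= a * e + b.
Proof.
move=> a0 b0 f0 g0 mg ge fg.
have : (Ehat calP (fun w => (f w)%:E) <= (a * e + b)%:E)%E.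
  apply: (@le_trans _ _ (Ehat calP (fun w => a%:E * g w + b%:E)%E)).
    apply: ge0_Ehat_le => //.
    by move=> w; rewrite adde_ge0// mule_ge0.
  rewrite (le_trans (ge0_Ehat_affine _ _ _ _ _))// EFinD EFinM leeD2r//.
  by rewrite lee_wpmul2l.
move=> h; rewrite /Eup -[leRHS]/(fine (a * e + b)%:E) fine_le//.
rewrite ge0_fin_numE; last exact: Ehat_ge0.
by rewrite (le_lt_trans h)// ltry.
Qed.

End upper_integrable.

(** * Uniform continuity on a compact interval *)

Section uniform_continuity_on_itv.
Context {R : realType}.
Implicit Types (T e : R) (x y : R -> R).

Definition itv_ucont T x := forall e, 0 < e -> exists2 d, 0 < d &
  forall s t, s \in `[0, T] -> t \in `[0, T] -> `|s - t| < d ->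
    `|x s - x t| <= e.

(** Heine-Cantor theorem through near-coverings: the radius [d] tends to 0 from the right and
    compactness is applied to [s] alone, [t] being unrestricted. *)
Lemma continuous_itv_ucont T x : continuous x -> itv_ucont T x.
Proof.
move=> cx e e0.
have /compact_near_coveringP/(_ R (0%R^'+)
  (fun d s => forall t, `|s - t| < d -> `|x s - x t| <= e) _)[] :=
  @segment_compact R 0 T.
  move=> s _; have /cvgrPdist_lt/(_ _ (divr_gt0 e0 (ltr0n _ 2))) := cx s.
  move=> /nbhs_ballP[r /= r0 rP].
  have r20 : 0 < r / 2 by rewrite divr_gt0.
  exists (ball s (r / 2), [set d | d < r / 2]); first split => /=.
  - exact: nbhsx_ballx.
  - exact: nbhs_right_lt.
  move=> [s' d] [/= ss' dr] t s't.
  have h1 : `|x s - x s'| < e / 2.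
    by apply: rP; rewrite /ball/= (lt_trans ss')// ltr_pdivrMr// ltr_pMr ?ltr1n.
  have h2 : `|x s - x t| < e / 2.
    apply: rP; rewrite /ball/= (le_lt_trans (ler_distD s' _ _))//.
    by rewrite (splitr r) ltrD// (lt_trans s't).
  rewrite (le_trans (ler_distD (x s) _ _))// (splitr e) lerD// ltW//.
  by rewrite distrC.
move=> d /= d0 dP; exists (d / 2); first by rewrite divr_gt0.
move=> s t sT tT; apply: (dP (d / 2)) => //=.
- by rewrite sub0r normrN gtr0_norm ?divr_gt0// ltr_pdivrMr// ltr_pMr ?ltr1n.
- by rewrite divr_gt0.
Qed.

Lemma itv_ucontD T x y : itv_ucont T x -> itv_ucont T y ->
  itv_ucont T (fun t => x t + y t).
Proof.
move=> ux uy e e0; have e20 : 0 < e / 2 by rewrite divr_gt0.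
have [d d0 dP] := ux _ e20; have [d' d'0 d'P] := uy _ e20.
exists (Num.min d d'); first by rewrite lt_min d0.
move=> s t sT tT; rewrite lt_min => /andP[std std'].
have -> : x s + y s - (x t + y t) = (x s - x t) + (y s - y t) by lra.
rewrite (le_trans (ler_normD _ _))// (splitr e) lerD//; first exact: dP.
exact: d'P.
Qed.

Lemma itv_ucont_approx T x :
  (forall e, 0 < e -> exists2 y, itv_ucont T y &
     forall t, t \in `[0, T] -> `|y t - x t| <= e) -> itv_ucont T x.
Proof.
move=> xy e e0; have e30 : 0 < e / 3 by rewrite divr_gt0.
have [y uy yx] := xy _ e30; have [d d0 dP] := uy _ e30.
exists d => // s t sT tT std.
have := dP _ _ sT tT std; have := yx _ sT; have := yx _ tT.
by rewrite !ler_norml; lra.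
Qed.

Lemma clampE T t : t \in `[0, T] -> clamp T t = t.
Proof.
by rewrite in_itv/= /clamp => /andP[t0 tT]; rewrite max_l// min_l.
Qed.

Lemma clamp_lip T s t : `|clamp T s - clamp T t| <= `|s - t|.
Proof.
have min_lip (a b : R) : `|Num.min a T - Num.min b T| <= `|a - b|.
  have h1 := ler_norm (a - b); have := ler_norm (b - a).
  rewrite [`|b - a|]distrC ler_norml => h2.
  by case: (leP a T) => ?; case: (leP b T) => ?; lra.
rewrite (le_trans (min_lip _ _))//.
have h1 := ler_norm (s - t); have := ler_norm (t - s).
rewrite [`|t - s|]distrC ler_norml => h2.
by case: (leP s 0) => ?; case: (leP t 0) => ?; lra.
Qed.

Lemma itv_ucont_continuous T x : 0 <= T -> itv_ucont T x ->
  continuous (fun t => x (clamp T t)).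
Proof.
move=> T0 ux t; apply/cvgrPdist_le => e e0; have [d d0 dP] := ux _ e0.
near=> s; apply: dP; rewrite ?clamp_itv//.
rewrite (le_lt_trans (clamp_lip _ _ _))//.
Unshelve. all: by end_near. Qed.

End uniform_continuity_on_itv.

(** * Continuous functionals on path space *)

Section path_functionals.
Context {R : realType} {T : R}.

Lemma cpath_itv_ucont (w : cpath T) : itv_ucont T w.
Proof. exact/continuous_itv_ucont/cpath_continuous. Qed.

Lemma cpath_lipschitz_continuous (f : cpath T -> R) (k : R) :
  (forall v w, `|f v - f w| <= k * cpath_dist v w) -> continuous f.
Proof.
move=> fk v; apply/(@cvgrPdist_lt _ _ _ (nbhs v)) => e e0; apply/nbhs_ballP.
have k0 : 0 < `|k| + 1 by rewrite ltr_wpDl.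
exists (e / (`|k| + 1)); first by rewrite /= divr_gt0.
move=> w; rewrite ballEmdist /= => vw; rewrite (le_lt_trans (fk _ _))//.
rewrite (@le_lt_trans _ _ ((`|k| + 1) * cpath_dist v w))//.
  by rewrite ler_wpM2r ?cpath_dist_ge0// ler_wpDr// ler_norm.
by rewrite mulrC -ltr_pdivlMr.
Qed.

Lemma cpath_continuous_measurable (f : cpath T -> R) :
  continuous f -> measurable_fun setT f.
Proof.
move=> cf; apply: measurability (RGenOpens.measurableE R) _.
move=> _ [_ [a [b ->] <-]]; rewrite setTI; apply: sub_sigma_algebra.
by move/continuousP: cf; apply; exact: interval_open.
Qed.

Lemma rV_norm_le n (x : 'rV[R]_n) (c : R) : 0 <= c ->
  (forall i, `|x ord0 i| <= c) -> `|x| <= c.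
Proof.
move=> c0 xc; rewrite [`|x|]mx_normrE; apply: bigmax_le => // -[i j] _ /=.
by rewrite ord1.
Qed.

End path_functionals.

(** * The modulus of continuity as a functional of the path *)

Section modulus_of_continuity.
Context {R : realType}.
Variables T : R.
Hypothesis T0 : 0 <= T.
Implicit Types x y : R -> R.

(** The scales [1 / (n + 1)] make it, for bounded [x], a decreasing sequence, as Dini's argument
    requires. *)
Definition modulus x (n : nat) : R := sup [set z | exists s t : R,
  [/\ s \in `[0, T], t \in `[0, T], `|s - t| < n.+1%:R^-1 & z = `|x s - x t|]].

Lemma modulus_le x n c : (forall s t, s \in `[0, T] -> t \in `[0, T] ->
  `|s - t| < n.+1%:R^-1 -> `|x s - x t| <= c) -> modulus x n <= c.
Proof.
move=> xc; apply: ge_sup.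
  by exists `|x 0 - x 0|, 0, 0; split; rewrite ?in_itv/= ?lexx ?subrr ?normr0.
by move=> _ [s [t [sT tT st ->]]]; exact: xc.
Qed.

Lemma modulus_ub x n (M : R) : (forall t, t \in `[0, T] -> `|x t| <= M) ->
  forall s t, s \in `[0, T] -> t \in `[0, T] ->
  `|s - t| < n.+1%:R^-1 -> `|x s - x t| <= modulus x n.
Proof.
move=> xM s t sT tT st; apply: ub_le_sup; last by exists s, t.
exists (M + M) => _ [s' [t' [s'T t'T _ ->]]].
by rewrite (le_trans (ler_normB _ _))// lerD// xM.
Qed.

Lemma modulus_ge0 x n : 0 <= modulus x n.
Proof.
rewrite /modulus; set A := [set z | _].
(* When the set is unbounded, [sup] has the default value 0. *)
have [[_ ubA]|/sup_out ->//] := pselect (has_sup A).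
rewrite (le_trans (normr_ge0 (x 0 - x 0)))//; apply: ub_le_sup => //.
by exists 0, 0; split; rewrite ?in_itv/= ?lexx ?subrr ?normr0 ?invr_gt0.
Qed.

Lemma modulus_nonincreasing x (M : R) m n :
  (forall t, t \in `[0, T] -> `|x t| <= M) ->
  (m <= n)%N -> modulus x n <= modulus x m.
Proof.
move=> xM mn; apply: modulus_le => s t sT tT st; apply: modulus_ub xM _ _ _ _ _ => //.
by rewrite (lt_le_trans st)// lef_pV2 ?posrE// ler_nat.
Qed.

(** Both values in an increment move by at most [d], hence the factor 2. For a simple process, whose
    trajectories depend on [w] in a Lipschitz way, this makes the modulus a continuous functional of
    [w]. *)
Lemma modulus_lipschitz x y n (M d : R) :
  (forall t, t \in `[0, T] -> `|x t| <= M) ->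
  (forall t, t \in `[0, T] -> `|y t| <= M) ->
  (forall t, t \in `[0, T] -> `|x t - y t| <= d) ->
  `|modulus x n - modulus y n| <= 2 * d.
Proof.
have main x' y' : (forall t, t \in `[0, T] -> `|y' t| <= M) ->
    (forall t, t \in `[0, T] -> `|x' t - y' t| <= d) ->
    modulus x' n <= modulus y' n + 2 * d.
  move=> yM xy; apply: modulus_le => s t sT tT st.
  have := modulus_ub yM sT tT st; have := xy _ sT; have := xy _ tT.
  by rewrite !ler_norml; lra.
move=> xM yM xy; have := main _ _ yM xy.
have : modulus y n <= modulus x n + 2 * d.
  by apply: main xM _ => t tT; rewrite distrC xy.
by rewrite ler_norml; lra.
Qed.

Lemma modulus_cvg0 x : itv_ucont T x -> modulus x n @[n --> \oo] --> 0.
Proof.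
move=> ux; apply/cvgrPdist_le => e e0; have [d d0 dP] := ux _ e0.
near=> n; rewrite sub0r normrN ger0_norm ?modulus_ge0//.
apply: modulus_le => s t sT tT st; apply: dP => //; rewrite (lt_trans st)//.
by near: n; exact: (near_infty_natSinv_lt (PosNum d0)).
Unshelve. all: by end_near. Qed.

End modulus_of_continuity.

(** * Simple processes *)

Section simple_processes.
Context {R : realType} {T : R}.

(** A simple process sees [w] only through its values at the times [min (tau i) s], which are
    1-Lipschitz in [s]; the Lipschitz function [f] transfers sup-distance bounds and the uniform
    continuity of [w]. *)
Lemma SG0_props (eta : R -> cpath T -> R) : SG0 eta -> exists M k : R,
  [/\ forall t w, t \in `[0, T] -> `|eta t w| <= M,
      forall t v w, t \in `[0, T] ->
        `|eta t v - eta t w| <= k * cpath_dist v w &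
      forall w, itv_ucont T (eta ^~ w)].
Proof.
move=> [n [tau [f [tauT [[M fM] [k fk]] etaE]]]].
have fL (x y : 'rV[R]_(1 + n)) (c : R) : 0 <= c ->
    (forall i, `|x ord0 i - y ord0 i| <= c) ->
    `|f x - f y| <= `|k| * c.
  move=> c0 xyc; have := fk (x, y) => /= /(_ (conj Logic.I Logic.I)) /le_trans.
  apply; rewrite (@le_trans _ _ (`|k| * `|x - y|))//.
    by rewrite ler_wpM2r// ler_norm.
  by rewrite ler_wpM2l//; apply: rV_norm_le => // i; rewrite !mxE.
have minT i s : s \in `[0, T] -> Num.min (tau i) s \in `[0, T].
  have := tauT i; rewrite !in_itv/= => /andP[? ?] /andP[? ?].
  by case: (leP (tau i) s) => _; apply/andP; split.
exists M, `|k|; split.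
- by move=> t w tT; rewrite etaE.
- move=> t v w tT; rewrite !etaE//; apply: fL; first exact: cpath_dist_ge0.
  move=> i; case: (split_ordP i) => j ->; rewrite ?row_mxEl ?row_mxEr !mxE.
    by rewrite subrr normr0 cpath_dist_ge0.
  by rewrite cpath_dist_ub// minT.
move=> w e e0; have k0 : 0 < `|k| + 1 by rewrite ltr_wpDl.
pose e' := e / (`|k| + 1); have e'0 : 0 < e' by rewrite divr_gt0.
have [d d0 dP] := cpath_itv_ucont w e'0.
(* The time itself is the first coordinate of [f], so [|s - t|] has to be below [e'] as well. *)
exists (Num.min d e'); first by rewrite lt_min d0.
move=> s t sT tT; rewrite lt_min => /andP[std ste]; rewrite !etaE//.
rewrite (@le_trans _ _ (`|k| * e'))//; last first.
  by rewrite /e' mulrCA ler_piMr ?(ltW e0)// ler_pdivrMr// mul1r lerDl.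
apply: fL => [|i]; first exact: ltW.
case: (split_ordP i) => j ->; rewrite ?row_mxEl ?row_mxEr !mxE; first exact: ltW.
apply: dP; rewrite ?minT// (le_lt_trans _ std)//.
have := ler_norm (s - t); have := ler_norm (t - s).
rewrite [`|t - s|]distrC ler_norml => h1 h2.
by case: (leP (tau j) s) => ?; case: (leP (tau j) t) => ?; lra.
Qed.

Lemma SG0_measurable (eta : R -> cpath T -> R) t :
  SG0 eta -> t \in `[0, T] -> measurable_fun setT (eta t).
Proof.
move=> /SG0_props[M [k [_ lip _]]] tT; apply: cpath_continuous_measurable.
by apply: cpath_lipschitz_continuous => v w; exact: lip.
Qed.

(** A deterministic bounded Lipschitz function is absorbed into [f], whose first coordinate is the
    time. *)
Lemma SG0_add_lipschitz (eta : R -> cpath T -> R) (g : R -> R) (M k : R) :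
  SG0 eta -> (forall t, `|g t| <= M) ->
  (forall s t, `|g s - g t| <= k * `|s - t|) ->
  SG0 (fun t w => eta t w + g t).
Proof.
move=> [n [tau [f [tauT [[N fN] [c fc]] etaE]]]] gM gk.
exists n, tau, (fun x => f x + g (x ord0 (lshift n ord0))); split => //; last first.
  by move=> s w sT; rewrite etaE// row_mxEl !mxE.
split.
  by exists (N + M) => x; rewrite (le_trans (ler_normD _ _))// lerD.
exists (c + `|k|) => -[x y] _ /=.
have := fc (x, y) (conj Logic.I Logic.I) => /= h.
have -> (a b a' b' : R) : a + b - (a' + b') = (a - a') + (b - b') by lra.
rewrite (le_trans (ler_normD _ _))// mulrDl lerD//.
rewrite (le_trans (gk _ _))//.
rewrite (@le_trans _ _ (`|k| * `|x ord0 (lshift n ord0) - y ord0 (lshift n ord0)|))//.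
  by rewrite ler_wpM2r// ler_norm.
rewrite ler_wpM2l//.
have -> : x ord0 (lshift n ord0) - y ord0 (lshift n ord0)
    = (x - y) ord0 (lshift n ord0) by rewrite !mxE.
rewrite [leRHS]mx_normrE.
exact: (@le_bigmax _ _ _ 0 (fun ij => `|(x - y) ij.1 ij.2|)
  (ord0, lshift n ord0)).
Qed.

End simple_processes.

(** * Weak compactness and Dini's theorem *)

Section weak_compactness.
Context {R : realType} {T : R}.
Variable calP : set (probability (cpath T) R).

Lemma cpath_bounded_integrable (P : probability (cpath T) R)
    (f : cpath T -> R) (M : R) : measurable_fun setT f ->
  (forall w, `|f w| <= M) -> P.-integrable setT (EFin \o f).
Proof.
move=> mf fM; apply/integrableP; split; first exact/measurable_EFinP.
rewrite (@le_lt_trans _ _ (\int[P]__ M%:E)%E)//; last first.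
  by rewrite probability_integral_cst ltry.
apply: ge0_le_integral => //.
- by apply/measurable_EFinP; exact: measurableT_comp.
- by move=> w _; rewrite /= lee_fin.
Qed.

Lemma weak_eval_continuous (f : bounded_continuous T) :
  continuous (fun P : initial_topology (@weak_eval R T) => weak_eval P f).
Proof.
move=> P.
have /cvg_sup/(_ f) evP :
  nbhs (weak_eval P : {ptws bounded_continuous T -> R}) -->
  (weak_eval P : {ptws bounded_continuous T -> R}) by [].
apply: (@cvg_comp _ _ _ (@weak_eval R T)
  (fun g : {ptws bounded_continuous T -> R} => g f)).
  exact: initial_continuous.
apply: (cvg_trans _ (@initial_continuous _ R^o
  (fun g : {ptws bounded_continuous T -> R} => g f) (weak_eval P))).
exact: (cvg_app (fun g : {ptws bounded_continuous T -> R} => g f) evP).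
Qed.

(* Dini's theorem for the functionals [P |-> E_P (h n)] on the weakly compact  *)
(* set calP.                                                                   *)
Lemma weakly_compact_dini (h : nat -> cpath T -> R) (M : R) :
  weakly_compact calP -> (forall n, continuous (h n)) ->
  (forall n w, 0 <= h n w <= M) ->
  (forall m n w, (m <= n)%N -> h n w <= h m w) ->
  (forall w, h n w @[n --> \oo] --> 0) ->
  forall e, 0 < e -> exists n, forall P, calP P ->
    (\int[P]_w (h n w)%:E <= e%:E)%E.
Proof.
move=> wc ch hM hni h0 e e0.
have hn n w : `|h n w| <= M.
  by have /andP[? ?] := hM n w; rewrite ger0_norm.
have mh n : measurable_fun setT (h n) by exact: cpath_continuous_measurable.
pose hb n : bounded_continuous T :=
  exist _ (h n) (conj (ch n) (ex_intro _ M (hn n))).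
have ih n (P : probability (cpath T) R) : P.-integrable setT (EFin \o h n).
  exact: cpath_bounded_integrable (mh n) (hn n).
have evalE n (P : probability (cpath T) R) :
    (weak_eval P (hb n))%:E = (\int[P]_w (h n w)%:E)%E.
  rewrite /weak_eval /Rintegral fineK//.
  exact: (integrable_fin_num measurableT (ih n P)).
have hE w : (h n w)%:E @[n --> \oo] --> 0%E.
  by apply/fine_cvgP; split; [exact: nearW|exact: h0].
(* For one measure this is dominated convergence, with the constant [M] as dominating function. *)
have small (P : probability (cpath T) R) :
    exists N, (\int[P]_w (h N w)%:E < e%:E)%E.
  have [_ _] := @dominated_convergence _ _ _ P setT measurableT
    (fun n => EFin \o h n) (cst 0%E) (EFin \o cst M)
    (fun n => (measurable_EFinP _ _).2 (mh n)) (measurable_cst _)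
    (aeW P (fun w _ => hE w))
    (cpath_bounded_integrable P (measurable_cst M) (fun=> lexx `|M|))
    (aeW P (fun w n _ => hn n w)).
  rewrite integral0 => /fine_cvgP[_] /cvgrPdist_lt /(_ _ e0)[N _ /(_ N)] /=.
  move=> /(_ (leqnn _)); rewrite sub0r normrN => hN; exists N.
  by rewrite -evalE lte_fin (le_lt_trans (ler_norm _)).
(* The strict bound on [h N] at [P] persists for weakly close measures, because [h N] is bounded
   continuous, and for larger indices, because [h] decreases. Compactness then provides one index
   for all of [calP]. *)
move/compact_near_coveringP: wc => /(_ nat \oo
  (fun n P => (\int[P]_w (h n w)%:E <= e%:E)%E) _)[].
  move=> P _.
  have [N PN] := small P.
  have /cvgrPdist_lt := @weak_eval_continuous (hb N) P.
  have eP0 : 0 < e - weak_eval P (hb N) by rewrite subr_gt0 -lte_fin evalE.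
  move=> /(_ _ eP0) nP.
  exists ([set Q | `|weak_eval P (hb N) - weak_eval Q (hb N)| <
      e - weak_eval P (hb N)], [set n | (N <= n)%N]).
    by split => //=; exists N.
  move=> [Q n] [/= PQ Nn]; rewrite (@le_trans _ _ (\int[Q]_w (h N w)%:E)%E)//.
    apply: le_integral => //; [exact: ih|exact: ih|].
    by move=> w _; rewrite lee_fin hni.
  rewrite -evalE lee_fin; move: PQ; rewrite ltr_norml; lra.
by move=> n _ nP; exists n => P PP; exact: (nP n (leqnn n) P PP).
Qed.

End weak_compactness.

(** * Continuity in mean of simple processes *)

Section simple_process_moduli.
Context {R : realType} {T : R}.
Variable calP : set (probability (cpath T) R).
Hypothesis T0 : 0 <= T.
Hypothesis calP0 : calP !=set0.

Lemma SG0_upper_integrable (eta : R -> cpath T -> R) t :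
  SG0 eta -> t \in `[0, T] -> upper_integrable calP (eta t).
Proof.
move=> eta0 tT; have [M [k [bM _ _]]] := SG0_props eta0.
apply: upper_integrable_le (upper_integrable_cst calP0 M) _ => //.
  by apply: measurable_qs => //; exact: SG0_measurable.
by apply: qsT => // w; exact: bM.
Qed.

(** An increment over less than [1 / (n + 1)] is bounded by the modulus of the trajectory at scale
    [n], a bounded continuous functional of the path that decreases to 0; [weakly_compact_dini]
    makes its expectation small uniformly over [calP]. *)
Lemma SG0_Eup_ucont (eta : R -> cpath T -> R) :
  weakly_compact calP -> SG0 eta ->
  forall e, 0 < e -> exists2 d, 0 < d & forall s t,
    s \in `[0, T] -> t \in `[0, T] -> `|s - t| < d ->
    Eup calP (fun w => `|eta s w - eta t w|) <= e.
Proof.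
move=> wc eta0 e e0; have [M [k [bM lip uc]]] := SG0_props eta0.
pose h n w := modulus T (eta ^~ w) n.
have bw w t : t \in `[0, T] -> `|eta t w| <= M by exact: bM.
have lh n v w : `|h n v - h n w| <= (2 * k) * cpath_dist v w.
  by rewrite -mulrA; apply: modulus_lipschitz (bw v) (bw w) _ => // t; exact: lip.
have hM n w : 0 <= h n w <= M + M.
  rewrite modulus_ge0//=; apply: modulus_le => // s t sT tT _.
  by rewrite (le_trans (ler_normB _ _))// lerD// bM.
have ch n : continuous (h n) by exact: cpath_lipschitz_continuous (lh n).
have [n hn] := weakly_compact_dini wc ch hM
  (fun m n w mn => modulus_nonincreasing T0 (bw w) mn)
  (fun w => modulus_cvg0 T0 (uc w)) e0.
exists n.+1%:R^-1 => [|s t sT tT st]; first by rewrite invr_gt0.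
have uN : upper_integrable calP (fun w => `|eta s w - eta t w|).
  apply: upper_integrable_norm => //.
  apply: upper_integrableD => //; first exact: SG0_upper_integrable.
  by under eq_fun do rewrite -mulN1r; apply: upper_integrableZ => //;
    exact: SG0_upper_integrable.
rewrite -lee_fin -EupE//; apply: Ehat_le => P PP.
rewrite (le_trans _ (hn P PP))//; apply: (ge0_qs_le_integral calP0 PP).
- by move=> w; rewrite lee_fin.
- by move=> w; rewrite lee_fin modulus_ge0.
by apply: qsT => // w; rewrite lee_fin; exact: modulus_ub (bw w) _ _ _ _ _.
Qed.

End simple_process_moduli.

(** * A countable dense set of times *)

Section dense_times.
Context {R : realType}.
Variable T : R.

(** Clamping puts every term in [[0, T]] and, being 1-Lipschitz, preserves density. *)
Definition dense_time (n : nat) : R :=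
  clamp T (ratr (odflt 0 (unpickle n : option rat))).

Lemma dense_time_itv n : 0 <= T -> dense_time n \in `[0, T].
Proof. by move=> T0; exact: clamp_itv. Qed.

Lemma dense_time_dense t d : t \in `[0, T] -> 0 < d ->
  exists n, `|dense_time n - t| < d.
Proof.
move=> tT d0; have [|q] := @rat_in_itvoo R (t - d) (t + d); first lra.
rewrite in_itv/= => /andP[q1 q2]; exists (pickle q).
rewrite /dense_time pickleK /= -[t in X in X < _](clampE tT).
rewrite (le_lt_trans (clamp_lip _ _ _))// ltr_norml; lra.
Qed.

Lemma itv_ucont_dense_le x c : 0 <= T -> itv_ucont T x ->
  (forall n, x (dense_time n) <= c) -> forall t, t \in `[0, T] -> x t <= c.
Proof.
move=> T0 ux xc t tT; apply/ler_addgt0Pr => e e0; have [d d0 dP] := ux _ e0.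
have [n nt] := dense_time_dense tT d0.
have := dP _ _ (dense_time_itv n T0) tT nt; have := xc n.
by rewrite ler_norml; lra.
Qed.

Lemma itv_ucont_norm x : itv_ucont T x -> itv_ucont T (fun t => `|x t|).
Proof.
move=> ux e /ux[d d0 dP]; exists d => // s t sT tT st.
by rewrite (le_trans (ler_dist_dist _ _))// dP.
Qed.

End dense_times.

(** * Inequalities for powers and the running supremum *)

Section sup_pow_theory.
Context {R : realType} {T : R}.
Variable p : R.
Hypothesis p1 : 1 <= p.
Hypothesis T0 : 0 <= T.
Implicit Type eta : R -> cpath T -> R.

Let p_gt0 : 0 < p. Proof. exact: lt_le_trans ltr01 p1. Qed.
Let p_ge0 : 0 <= p. Proof. exact: ltW. Qed.

Lemma sup_pow_ge0 eta w : (0 <= sup_pow p eta w)%E.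
Proof.
rewrite (@le_trans _ _ (`|eta 0 w| `^ p)%:E) ?lee_fin ?powR_ge0//.
by apply: ereal_sup_ubound; exists 0 => //=; rewrite in_itv/= lexx.
Qed.

Lemma sup_pow_ub eta w t :
  t \in `[0, T] -> ((`|eta t w| `^ p)%:E <= sup_pow p eta w)%E.
Proof. by move=> tT; apply: ereal_sup_ubound; exists t. Qed.

Lemma sup_pow_le eta w (c : \bar R) :
  (forall t, t \in `[0, T] -> ((`|eta t w| `^ p)%:E <= c)%E) ->
  (sup_pow p eta w <= c)%E.
Proof. by move=> h; apply: ge_ereal_sup => _ [t tT <-]; exact: h. Qed.

Lemma ler_powR2r (a b : R) : 0 <= a -> 0 <= b -> (a `^ p <= b `^ p) = (a <= b).
Proof.
move=> a0 b0; apply/idP/idP => [|ab]; last first.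
  by rewrite ge0_ler_powR// nnegrE.
by rewrite !leNgt; apply: contra => ba; rewrite gt0_ltr_powR// nnegrE.
Qed.

Lemma sup_pow_le_powRP eta w (c : R) : 0 <= c ->
  (sup_pow p eta w <= (c `^ p)%:E)%E <->
  forall t, t \in `[0, T] -> `|eta t w| <= c.
Proof.
move=> c0; split=> [h t tT|h].
  by rewrite -ler_powR2r// -lee_fin (le_trans _ h)// sup_pow_ub.
by apply: sup_pow_le => t tT; rewrite lee_fin ler_powR2r// h.
Qed.

Lemma powRVK (c : R) : 0 <= c -> (c `^ p^-1) `^ p = c.
Proof. by move=> c0; rewrite -powRrM mulVf ?powRr1// gt_eqF. Qed.

Lemma powRKV (c : R) : 0 <= c -> (c `^ p) `^ p^-1 = c.
Proof. by move=> c0; rewrite -powRrM mulfV ?powRr1// gt_eqF. Qed.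

(** For [y > e], the ratio [y / e] is at least 1 and so at most its own [p]-th power. The inequality
    passes from [p]-th moments to first moments in place of Hölder's inequality, with [e] free to
    choose. *)
Lemma le_linear_powR (e y : R) : 0 < e -> 0 <= y ->
  y <= e `^ (1 - p) * y `^ p + e.
Proof.
move=> e0 y0; have [ye|ey] := leP y e.
  by rewrite ler_wpDl// mulr_ge0 ?powR_ge0.
have y_gt0 : 0 < y by exact: lt_trans ey.
rewrite ler_wpDr ?(ltW e0)// powRB ?(gt_eqF e0) ?implybT// powRr1 ?(ltW e0)//.
have z1 : 1 <= y / e by rewrite ler_pdivlMr// mul1r ltW.
have yE : y = y / e * e by rewrite divfK// gt_eqF.
have ep0 : e `^ p != 0 by rewrite gt_eqF// powR_gt0.
rewrite {2}yE powRM ?(ltW e0) ?(le_trans ler01 z1)//.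
by rewrite mulrACA mulVf// mulr1 {1}yE mulrC ler_pM2l// le1r_powR.
Qed.

(** From [a + b <= 2 * max a b]. *)
Lemma powRD_le (a b : R) : 0 <= a -> 0 <= b ->
  (a + b) `^ p <= 2 `^ p * (a `^ p + b `^ p).
Proof.
move=> a0 b0; rewrite (@le_trans _ _ ((2 * Num.max a b) `^ p))//.
  rewrite ler_powR2r ?addr_ge0 ?mulr_ge0 ?le_max ?a0//.
  by case: (leP a b) => ?; lra.
rewrite powRM ?le_max ?a0// ler_wpM2l ?powR_ge0//.
by case: (leP a b) => _; rewrite ?lerDl ?lerDr powR_ge0.
Qed.

Lemma esups0_ub (u : nat -> \bar R) n : (u n <= esups u 0%N)%E.
Proof. by apply: ereal_sup_ubound; exists n. Qed.

Lemma esups0_le (u : nat -> \bar R) c :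
  (forall n, u n <= c)%E -> (esups u 0%N <= c)%E.
Proof. by move=> h; apply: ge_ereal_sup => _ [n _ <-]; exact: h. Qed.

(** A countable supremum, which is what makes [sup_pow] measurable up to q.s. equality in
    [qs_measurable_sup_pow]. *)
Lemma sup_pow_dense eta w : itv_ucont T (eta ^~ w) ->
  sup_pow p eta w = esups (fun n => (`|eta (dense_time T n) w| `^ p)%:E) 0%N.
Proof.
move=> uc; set u := fun n => _; apply/eqP; rewrite eq_le; apply/andP; split.
  case E : (esups u 0%N) => [r| |]; rewrite ?leey//.
  - have r0 : 0 <= r.
      rewrite -lee_fin -E (le_trans _ (esups0_ub u 0%N))//.
      by rewrite lee_fin powR_ge0.
    rewrite -(powRVK r0); apply/sup_pow_le_powRP; first exact: powR_ge0.
    apply: itv_ucont_dense_le => //; first exact: itv_ucont_norm.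
    move=> n; rewrite -ler_powR2r ?powR_ge0// powRVK// -lee_fin -E.
    exact: (esups0_ub u n).
  - have := esups0_ub u 0%N; rewrite E.
    by rewrite leNgt ltNyr.
by apply: esups0_le => n; apply: sup_pow_ub; exact: dense_time_itv.
Qed.

End sup_pow_theory.

(** * Processes in the completion: continuous paths, integrability, continuity in mean *)

Section SG_theory.
Context {R : realType} {T : R}.
Variable calP : set (probability (cpath T) R).
Variable p : R.
Hypothesis p1 : 1 <= p.
Hypothesis T0 : 0 <= T.
Hypothesis calP0 : calP !=set0.
Implicit Types eta X S : R -> cpath T -> R.

Let p_gt0 : 0 < p. Proof. exact: lt_le_trans ltr01 p1. Qed.
Let p_ge0 : 0 <= p. Proof. exact: ltW. Qed.

Definition process_sub eta X : R -> cpath T -> R := fun t w => eta t w - X t w.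

Lemma SG_measurable S t : SG calP p S -> t \in `[0, T] ->
  qs_measurable_real calP (S t).
Proof. by move=> [mS _] /mS /qs_measurableP. Qed.

Lemma SG_approx S e : SG calP p S -> 0 < e -> exists2 eta, SG0 eta &
  qs_measurable calP (sup_pow p (process_sub eta S)) /\
  (Ehat calP (sup_pow p (process_sub eta S)) <= e%:E)%E.
Proof.
move=> [_ [eta_ eta0 [meta /fine_cvgP[nfin ncvg]]]] e0.
have c0 : 0 < e `^ p^-1 by exact: powR_gt0.
move/cvgrPdist_lt : ncvg => /(_ _ c0) nlt.
have [n _ /(_ n (leqnn n)) /= [fn ln]] := filterI nfin nlt.
exists (eta_ n) => //; split; first exact: meta.
move: fn ln; rewrite /= sub0r normrN /SG_norm.
set E := Ehat _ _ => fn.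
have E0 : (0 <= E)%E by apply: Ehat_ge0 => // w; exact: sup_pow_ge0.
rewrite ger0_norm ?fine_ge0 ?poweR_ge0// -lte_fin fineK// -poweR_EFin => ln.
rewrite leNgt; apply/negP => eE; move: ln; apply/negP; rewrite -leNgt.
apply: gt0_ler_poweR; rewrite ?invr_ge0 ?in_itv/= ?leey ?andbT ?lee_fin ?(ltW e0)//.
exact: ltW.
Qed.

(** Converse of [SG_approx]: approximants whose [p]-th power has expectation at most
    [(1 / (n + 1)) ^ p] have norms at most [1 / (n + 1)]. *)
Lemma SG_intro X : (forall t, t \in `[0, T] -> qs_measurable_real calP (X t)) ->
  (forall e, 0 < e -> exists2 eta, SG0 eta &
    qs_measurable calP (sup_pow p (process_sub eta X)) /\
    (Ehat calP (sup_pow p (process_sub eta X)) <= e%:E)%E) -> SG calP p X.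
Proof.
move=> mX happrox; split; first by move=> t tT; apply/qs_measurableP/mX.
have /choice[eta_ etaP] n : exists eta, SG0 eta /\
    qs_measurable calP (sup_pow p (process_sub eta X)) /\
    (Ehat calP (sup_pow p (process_sub eta X)) <= (n.+1%:R^-1 `^ p)%:E)%E.
  have [|eta eta0 etaE] := happrox (n.+1%:R^-1 `^ p); last by exists eta.
  by rewrite powR_gt0// invr_gt0.
exists eta_; first by move=> n; have [] := etaP n.
split; first by move=> n; have [_ []] := etaP n.
apply: (@squeeze_cvge _ _ _ _ (cst 0%E) _ (fun n => (n.+1%:R^-1 : R)%:E)).
- near=> n; rewrite poweR_ge0/=; have [_ [_]] := etaP n.
  rewrite /SG_norm; set E := Ehat _ _ => En.
  have E0 : (0 <= E)%E by apply: Ehat_ge0 => // w; exact: sup_pow_ge0.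
  rewrite -[X in (_ <= X%:E)%E](powRKV p1) ?invr_ge0// -poweR_EFin.
  by apply: gt0_ler_poweR; rewrite ?invr_ge0 ?in_itv/= ?leey ?andbT ?lee_fin ?powR_ge0.
- exact: cvg_cst.
- apply: cvg_EFin; first exact: nearW.
  apply/cvgrPdist_le => e e0; near=> n.
  rewrite sub0r normrN ger0_norm ?invr_ge0// ltW//.
  by near: n; exact: (near_infty_natSinv_lt (PosNum e0)).
Unshelve. all: by end_near. Qed.

(** Chebyshev's inequality: the set where every [g_ n] is at least [c] has measure at most
    [Ehat (g_ n) / c] for each [n], hence is polar. *)
Lemma qs_exists_le (g_ : nat -> cpath T -> \bar R) (c : R) : 0 < c ->
  (forall n w, 0 <= g_ n w)%E -> (forall n, qs_measurable calP (g_ n)) ->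
  (forall e, 0 < e -> exists n, (Ehat calP (g_ n) <= e%:E)%E) ->
  qs calP (fun w => exists n, (g_ n w <= c%:E)%E).
Proof.
move=> c0 g0 mg gE.
have /choice[h_ hP] n : exists h : cpath T -> \bar R,
    measurable_fun setT h /\ qs calP (fun w => g_ n w = h w).
  by have [h mh gh] := mg n; exists h.
pose N := \bigcap_n [set w | (c%:E <= `|h_ n w|)%E].
have mN_ n : measurable [set w | (c%:E <= `|h_ n w|)%E].
  rewrite -[X in measurable X]setTI; apply: emeasurable_fun_c_infty => //.
  by apply: measurableT_comp => //; have [] := hP n.
have mN : measurable N by apply: bigcapT_measurable => n; exact: mN_.
have pN : polar calP N.
  apply/polarP => //; split=> // P PP; apply/eqP; rewrite eq_le measure_ge0 andbT.
  apply/lee_addgt0Pr => e e0; rewrite add0e.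
  have [n En] := gE _ (mulr_gt0 e0 c0); have [mh gh] := hP n.
  rewrite (@le_trans _ _ (P [set w | (c%:E <= `|h_ n w|)%E]))//.
    by apply: le_measure; rewrite ?inE// => w; exact.
  have := le_integral_abse P measurableT mh c0; rewrite setTI => hc.
  rewrite -(@lee_pmul2l _ c%:E) ?lte_fin// (le_trans hc)//.
  rewrite -EFinM [c * e]mulrC (le_trans _ En)// (le_trans _ (Ehat_ub _ PP))//.
  rewrite (qs_integral calP0 PP (g := g_ n))//; apply: qsW gh => w <-.
  by rewrite gee0_abs.
have gh : qs calP (fun w => forall n, g_ n w = h_ n w).
  by apply: qs_forall_nat => // n; have [] := hP n.
have Nc : qs calP (fun w => ~ N w) by exists N.
apply: qsW (qs_and calP0 gh Nc) => w [gE' /existsNP[n /not_implyP[_ /negP]]].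
by rewrite -ltNge => hn; exists n; rewrite -(gee0_abs (g0 _ _)) gE' ltW.
Qed.

(** By [qs_exists_le], quasi-surely and for every [k], some simple process is within [1 / (k + 1)]
    of the path uniformly in time, its index depending on [w]. The path is therefore a uniform limit
    of uniformly continuous ones. *)
Lemma SG_itv_ucont S : SG calP p S -> qs calP (fun w => itv_ucont T (S ^~ w)).
Proof.
move=> SGS.
have /choice[eta_ etaP] n : exists eta, SG0 eta /\
    qs_measurable calP (sup_pow p (process_sub eta S)) /\
    (Ehat calP (sup_pow p (process_sub eta S)) <= (n.+1%:R^-1)%:E)%E.
  have [|eta eta0 etaE] := @SG_approx S n.+1%:R^-1 SGS; last by exists eta.
  by rewrite invr_gt0.
have : qs calP (fun w => forall k, exists n,
    (sup_pow p (process_sub (eta_ n) S) w <= (k.+1%:R^-1 `^ p)%:E)%E).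
  apply: qs_forall_nat => // k.
  have ck : 0 < (k.+1%:R^-1 : R) `^ p by rewrite powR_gt0// invr_gt0.
  apply: (qs_exists_le ck).
  - by move=> n w; exact: sup_pow_ge0.
  - by move=> n; have [_ []] := etaP n.
  move=> e e0; have [n _ nP] := near_infty_natSinv_lt (PosNum e0).
  exists n; have [_ [_ En]] := etaP n; rewrite (le_trans En)// lee_fin ltW//.
  exact: (nP n (leqnn n)).
apply: qsW => w wP; apply: itv_ucont_approx => e e0.
have [k _ kP] := near_infty_natSinv_lt (PosNum e0).
have [n] := wP k; rewrite sup_pow_le_powRP// => wn.
exists (eta_ n ^~ w).
  by have [eta0 _] := etaP n; have [M [c [_ _]]] := SG0_props eta0; exact.
by move=> t /wn /le_trans; apply; rewrite ltW//; exact: (kP k (leqnn k)).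
Qed.

Lemma qs_measurable_sup_pow X :
  (forall t, t \in `[0, T] -> qs_measurable_real calP (X t)) ->
  qs calP (fun w => itv_ucont T (X ^~ w)) -> qs_measurable calP (sup_pow p X).
Proof.
move=> mX ucX.
have /choice[h_ hP] n : exists h : cpath T -> R,
    measurable_fun setT h /\ qs calP (fun w => X (dense_time T n) w = h w).
  by have [h mh Xh] := mX _ (dense_time_itv n T0); exists h.
exists (fun w => esups (fun n => (`|h_ n w| `^ p)%:E) 0%N).
  apply: measurable_fun_esups => n; apply/measurable_EFinP.
  apply: (measurableT_comp (measurable_powR p)).
  by apply: measurableT_comp => //; have [] := hP n.
have Xh : qs calP (fun w => forall n, X (dense_time T n) w = h_ n w).
  by apply: qs_forall_nat => // n; have [] := hP n.
apply: qsW (qs_and calP0 ucX Xh) => w [uc Xw].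
rewrite sup_pow_dense//; congr (esups _ _); apply/funext => n.
by rewrite Xw.
Qed.

Lemma upper_integrable_affine (f : cpath T -> R) (g : cpath T -> \bar R)
    (a b e : R) :
  0 <= a -> 0 <= b -> (forall w, 0 <= g w)%E -> qs_measurable calP g ->
  (Ehat calP g <= e%:E)%E -> qs_measurable_real calP f ->
  qs calP (fun w => `|f w|%:E <= a%:E * g w + b%:E)%E ->
  upper_integrable calP f.
Proof.
move=> a0 b0 g0 mg ge mf fg; split => //; exists (a * e + b) => P PP.
apply: (@le_trans _ _ (\int[P]_w (a%:E * g w + b%:E))%E).
  apply: (ge0_qs_le_integral calP0 PP) => //.
  by move=> w; rewrite adde_ge0// mule_ge0.
rewrite (le_trans (Ehat_ub _ PP))//.
rewrite (le_trans (ge0_Ehat_affine _ _ _ _ _))// EFinD EFinM leeD2r//.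
by rewrite lee_wpmul2l.
Qed.

Lemma le_affine_sup_pow eta w t (d : R) : 0 < d -> t \in `[0, T] ->
  (`|eta t w|%:E <= (d `^ (1 - p))%:E * sup_pow p eta w + d%:E)%E.
Proof.
move=> d0 tT.
rewrite (@le_trans _ _ (d `^ (1 - p) * `|eta t w| `^ p + d)%:E)//.
  by rewrite lee_fin le_linear_powR.
by rewrite EFinD EFinM leeD2r// lee_wpmul2l ?lee_fin ?powR_ge0// sup_pow_ub.
Qed.

Lemma SG_close S e : SG calP p S -> 0 < e -> exists2 eta, SG0 eta &
  forall t, t \in `[0, T] ->
    upper_integrable calP (fun w => eta t w - S t w) /\
    Eup calP (fun w => `|eta t w - S t w|) <= e.
Proof.
move=> SGS e0; have d0 : 0 < e / 2 by rewrite divr_gt0.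
pose a := (e / 2) `^ (1 - p); have a0 : 0 < a by exact: powR_gt0.
(* [le_linear_powR] at level [e / 2] then bounds the first moment by
   [a * (e / 2 / a) + e / 2 = e]. *)
have [|eta eta0 [meta Eeta]] := @SG_approx S (e / 2 / a) SGS.
  by rewrite divr_gt0.
exists eta => // t tT.
have le w := le_affine_sup_pow (process_sub eta S) w d0 tT.
split.
  apply: upper_integrable_affine (ltW a0) (ltW d0) _ meta Eeta _ _ => //.
  - by move=> w; exact: sup_pow_ge0.
  - apply: qs_measurable_realD => //; last first.
      by apply: qs_measurable_realN; exact: SG_measurable.
    by apply: measurable_qs => //; exact: SG0_measurable.
  - by apply: qsT => // w; exact: le.
rewrite (@le_trans _ _ (a * (e / 2 / a) + e / 2))//.
  apply: (ge0_Eup_le_affine calP0 _ _ _ _ meta Eeta); rewrite ?(ltW a0) ?(ltW d0)//.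
  - by move=> w; exact: sup_pow_ge0.
  - by apply: qsT => // w; exact: le.
by rewrite mulrC divfK ?gt_eqF//; lra.
Qed.

Lemma upper_integrableB (f g : cpath T -> R) : upper_integrable calP f ->
  upper_integrable calP g -> upper_integrable calP (fun w => f w - g w).
Proof.
move=> uf ug; apply: upper_integrableD => //.
by under eq_fun do rewrite -mulN1r; exact: upper_integrableZ.
Qed.

Lemma SG_upper_integrable S t : SG calP p S -> t \in `[0, T] ->
  upper_integrable calP (S t).
Proof.
move=> SGS tT; have [eta eta0 /(_ t tT)[u _]] := SG_close SGS ltr01.
have -> : S t = (fun w => eta t w - (eta t w - S t w)).
  by apply/funext => w; rewrite opprB addrC subrK.
by apply: upper_integrableB => //; exact: SG0_upper_integrable.
Qed.

(** A three-epsilon argument from [SG0_Eup_ucont], since the approximation of [SG_close] is uniform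
    in time. *)
Lemma SG_Eup_ucont S : weakly_compact calP -> SG calP p S ->
  forall e, 0 < e -> exists2 d, 0 < d & forall s t,
    s \in `[0, T] -> t \in `[0, T] -> `|s - t| < d ->
    Eup calP (fun w => `|S s w - S t w|) <= e.
Proof.
move=> wc SGS e e0; have e30 : 0 < e / 3 by rewrite divr_gt0.
have [eta eta0 etaS] := SG_close SGS e30.
have [d d0 dP] := SG0_Eup_ucont T0 calP0 wc eta0 e30.
exists d => // s t sT tT st.
have [us es] := etaS s sT; have [ut et] := etaS t tT.
have u1 : upper_integrable calP (fun w => `|eta s w - eta t w|).
  by apply/upper_integrable_norm => //; apply: upper_integrableB;
    exact: SG0_upper_integrable.
have u2 : upper_integrable calP
    (fun w => `|eta s w - S s w| + `|eta t w - S t w|).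
  by apply: upper_integrableD => //; exact: upper_integrable_norm.
have -> : e = e / 3 + (e / 3 + e / 3) by lra.
apply: (@le_trans _ _ (Eup calP (fun w => `|eta s w - eta t w|) +
    Eup calP (fun w => `|eta s w - S s w| + `|eta t w - S t w|))).
  apply: Eup_le_add => //.
    by apply: upper_integrable_norm => //; apply: upper_integrableB;
      exact: SG_upper_integrable.
  apply: qsT => // w; rewrite ler_norml.
  have := ler_norm (eta s w - S s w); have := ler_norm (eta t w - S t w).
  have := ler_norm (eta s w - eta t w).
  have := ler_norm (- (eta s w - S s w)); have := ler_norm (- (eta t w - S t w)).
  have := ler_norm (- (eta s w - eta t w)); rewrite !normrN; lra.
rewrite lerD//; first exact: dP.
rewrite (le_trans _ (lerD es et))//; apply: Eup_le_add => //.
- exact: upper_integrable_norm.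
- exact: upper_integrable_norm.
exact: qsT.
Qed.

End SG_theory.

(** * Uniform approximation by Lipschitz functions *)

Section lipschitz_approximation.
Context {R : realType}.
Implicit Types x y : R -> R.

Lemma itv_ucontN T x : itv_ucont T x -> itv_ucont T (fun t => - x t).
Proof.
move=> ux e /ux[d d0 dP]; exists d => // s t sT tT st.
by rewrite -opprD normrN dP.
Qed.

Lemma itv_ucont_bounded T x : 0 <= T -> itv_ucont T x ->
  exists M, forall t, t \in `[0, T] -> x t <= M.
Proof.
move=> T0 ux; have cx := itv_ucont_continuous T0 ux.
have [c cT cM] := EVT_max T0 (continuous_subspaceT (A := `[0, T]%classic) cx).
by exists (x (clamp T c)) => t tT; have := cM _ tT; rewrite clampE.
Qed.

(* g is the inf-convolution of x with k |.|. *)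
Lemma lipschitz_approx x (M e : R) : 0 < e ->
  (forall t, 0 <= x t <= M) ->
  (forall e, 0 < e -> exists2 d, 0 < d &
     forall s t, `|s - t| < d -> `|x s - x t| <= e) ->
  exists (g : R -> R) (k : R), [/\ forall t, `|g t| <= M,
    forall s t, `|g s - g t| <= k * `|s - t| &
    forall t, `|g t - x t| <= e].
Proof.
move=> e0 xM ux; have [d d0 dP] := ux _ e0.
have M0 : 0 <= M by have /andP[] := xM 0; exact: le_trans.
(* With slope [M / d], a point at distance at least [d] from [t] pays at least [M] and cannot
   undercut [x t]; a nearer point undercuts it by at most [e]. *)
have [k k0 kd] : exists2 k : R, 0 <= k & M <= k * d.
  by exists (M / d); rewrite ?divfK ?gt_eqF// divr_ge0// ltW.
pose g t := inf (range (fun s => x s + k * `|t - s|)).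
have g_le (t s : R) : g t <= x s + k * `|t - s|.
  apply: ge_inf; last by exists s.
  exists 0 => _ [r _ <-]; rewrite addr_ge0 ?mulr_ge0//.
  by have /andP[] := xM r.
have le_g u c : (forall s, c <= x s + k * `|u - s|) -> c <= g u.
  move=> h; apply: lb_le_inf; first by exists (x 0 + k * `|u - 0|), 0.
  by move=> _ [s _ <-].
have g0 t : 0 <= g t.
  by apply: le_g => s; have /andP[? _] := xM s; rewrite addr_ge0 ?mulr_ge0.
have gx t : g t <= x t by have := g_le t t; rewrite subrr normr0 mulr0 addr0.
have g_lip s t : g s <= g t + k * `|s - t|.
  rewrite -lerBlDr; apply: le_g => r; rewrite lerBlDr (le_trans (g_le s r))//.
  by rewrite -addrA lerD2l -mulrDr ler_wpM2l// [leRHS]addrC ler_distD.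
exists g, k; split.
- move=> t; rewrite ger0_norm// (le_trans (gx t))//.
  by have /andP[] := xM t.
- move=> s t; have := g_lip s t; have := g_lip t s.
  by rewrite [`|t - s|]distrC ler_norml; lra.
- move=> t; rewrite ler0_norm ?subr_le0// opprB lerBlDr addrC -lerBlDr.
  apply: le_g => s; have /andP[xs0 xsM] := xM s; have /andP[xt0 xtM] := xM t.
  have [std|std] := ltP `|t - s| d.
    have := dP _ _ std; have : 0 <= k * `|t - s| by rewrite mulr_ge0.
    by rewrite ler_norml; lra.
  have : M <= k * `|t - s|.
    by rewrite (le_trans kd)// ler_wpM2l.
  by lra.
Qed.

End lipschitz_approximation.

(** * Adding a deterministic nondecreasing process *)

Section add_deterministic.
Context {R : realType} {T : R}.
Variable calP : set (probability (cpath T) R).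
Variable p : R.
Hypothesis p1 : 1 <= p.
Hypothesis T0 : 0 <= T.
Hypothesis calP0 : calP !=set0.

Lemma incr_fun_lipschitz_approx (A : incr_fun T) (e : R) : 0 < e ->
  exists (g : R -> R) (M k : R), [/\ forall t, `|g t| <= M,
    forall s t, `|g s - g t| <= k * `|s - t| &
    forall t, `|g t - A t| <= e].
Proof.
move=> e0; have [||g [k gP]] := @lipschitz_approx R A (A T) e e0; last first.
- by exists g, (A T), k.
- move=> e' e'0.
  have [d d0 dP] := @continuous_itv_ucont _ T _ (@incr_fun_continuous _ _ A) _ e'0.
  exists d => // s t st; rewrite (incr_fun_frozen A s) (incr_fun_frozen A t).
  by apply: dP; rewrite ?clamp_itv// (le_lt_trans (clamp_lip _ _ _)).
move=> t; rewrite (incr_fun_frozen A t) -{1}(incr_fun0 A).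
have := clamp_itv t T0; rewrite in_itv/= => /andP[c0 cT].
by apply/andP; split; exact: (@incr_fun_nd _ _ A).
Qed.

(** [A] is merely continuous, so it cannot be absorbed directly into a simple process; a Lipschitz
    function uniformly close to [A] can, and the error is uniform in [t] and [w]. *)
Lemma SG_add_incr_fun (S : R -> cpath T -> R) (A : incr_fun T) :
  SG calP p S -> SG calP p (fun t w => S t w + A t).
Proof.
move=> SGS.
have mX t : t \in `[0, T] -> qs_measurable_real calP (fun w => S t w + A t).
  move=> tT; apply: qs_measurable_realD => //; first exact: SG_measurable SGS tT.
  exact: measurable_qs.
apply: SG_intro => // e e0.
pose c := 2 `^ p : R; have c0 : 0 < c by rewrite powR_gt0.
have b0 : 0 < e / 2 / c by rewrite !divr_gt0.
have [eta eta0 [meta Eeta]] := SG_approx p1 T0 calP0 SGS b0.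
(* Chosen so that [c * d ^ p = e / 2]; the approximation of [S] accounts for the other half. *)
pose d := (e / 2 / c) `^ p^-1; have d0 : 0 < d by rewrite powR_gt0.
have [g [M [k [gM gk gA]]]] := incr_fun_lipschitz_approx A d0.
have zeta0 := SG0_add_lipschitz eta0 gM gk.
exists (fun t w => eta t w + g t) => //; split.
  apply: qs_measurable_sup_pow => //.
    move=> t tT; apply: qs_measurable_realD => //.
      by apply: measurable_qs => //; exact: SG0_measurable zeta0 tT.
    by apply: qs_measurable_realN => //; exact: mX.
  apply: qsW (SG_itv_ucont p1 T0 calP0 SGS) => w Sw.
  have [? [? [_ _ zw]]] := SG0_props zeta0.
  apply: itv_ucontD => //; apply: itv_ucontN; apply: itv_ucontD => //.
  exact/continuous_itv_ucont/incr_fun_continuous.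
apply: (@le_trans _ _ (Ehat calP
    (fun w => c%:E * sup_pow p (process_sub eta S) w + (e / 2)%:E)%E)).
  apply: ge0_Ehat_le => //.
  - by move=> w; exact: sup_pow_ge0.
  - move=> w; rewrite adde_ge0 ?lee_fin ?divr_ge0 ?(ltW e0)//.
    by rewrite mule_ge0 ?lee_fin ?(ltW c0)//; exact: sup_pow_ge0.
  apply: qsT => // w; apply: sup_pow_le => t tT; rewrite /process_sub.
  have -> : eta t w + g t - (S t w + A t) = (eta t w - S t w) + (g t - A t).
    by lra.
  apply: (@le_trans _ _ (c * (`|eta t w - S t w| `^ p + d `^ p))%:E).
    rewrite lee_fin (le_trans _ (powRD_le p1 _ (ltW d0)))//.
    rewrite ler_powR2r// ?addr_ge0 ?(ltW d0)// (le_trans (ler_normD _ _))//.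
    by rewrite lerD2l gA.
  rewrite mulrDr EFinD EFinM leeD//.
    apply: lee_wpmul2l; rewrite ?lee_fin ?(ltW c0)//.
    exact: (@sup_pow_ub _ _ p (process_sub eta S)).
  by rewrite lee_fin /d powRVK ?(ltW b0)// mulrC divfK// gt_eqF.
rewrite (le_trans (ge0_Ehat_affine _ _ _ _ _))//; rewrite ?(ltW c0) ?divr_ge0 ?(ltW e0)//.
  by move=> w; exact: sup_pow_ge0.
rewrite [X in (_ <= X%:E)%E](_ : e = c * (e / 2 / c) + e / 2); last first.
  by rewrite mulrC divfK ?gt_eqF//; lra.
by rewrite EFinD (EFinM c) leeD2r// lee_wpmul2l ?lee_fin ?(ltW c0).
Qed.

End add_deterministic.

(** * The running maximum of the obstacle *)

Section running_maximum.
Context {R : realType}.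
Variables (T : R) (a : R -> R).
Hypothesis T0 : 0 <= T.
Hypothesis ua : itv_ucont T a.
Hypothesis a0 : a 0 <= 0.

(** The clamp makes it constant on each side of [[0, T]]; the truncation at 0, with [a 0 <= 0],
    makes it start at 0. *)
Definition runmax (t : R) : R :=
  sup [set Num.max (a s) 0 | s in `[0, clamp T t]%classic].

Lemma runmax_ub s t : s \in `[0, T] -> t \in `[0, T] -> s <= t ->
  Num.max (a s) 0 <= runmax t.
Proof.
move=> sT tT st; rewrite /runmax clampE//; move: sT tT.
rewrite !in_itv/= => /andP[s0 sT] /andP[t0 tT].
apply: ub_le_sup; last by exists s => //=; rewrite in_itv/= s0.
have [M aM] := itv_ucont_bounded T0 ua.
exists (Num.max M 0) => _ [r /= + <-]; rewrite in_itv/= => /andP[r0 rt].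
rewrite ge_max !le_max lexx orbT andbT aM// in_itv/= r0/=.
exact: le_trans rt tT.
Qed.

Lemma runmax_le t c : t \in `[0, T] -> 0 <= c ->
  (forall s, s \in `[0, T] -> s <= t -> a s <= c) -> runmax t <= c.
Proof.
move=> tT c0 h; rewrite /runmax clampE//.
have /andP[t0 tleT] : 0 <= t <= T by move: tT; rewrite in_itv.
apply: ge_sup.
  by exists (Num.max (a 0) 0), 0 => //=; rewrite in_itv/= lexx.
move=> _ [s /= + <-]; rewrite in_itv/= => /andP[s0 st].
by rewrite ge_max c0 andbT h// in_itv/= s0/= (le_trans st).
Qed.

Lemma runmax_ge s t : s \in `[0, T] -> t \in `[0, T] -> s <= t -> a s <= runmax t.
Proof.
by move=> sT tT st; rewrite (le_trans _ (runmax_ub sT tT st))// le_max lexx.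
Qed.

Lemma runmax_ge0 t : t \in `[0, T] -> 0 <= runmax t.
Proof. by move=> tT; rewrite (le_trans _ (runmax_ub tT tT _))// le_max lexx orbT. Qed.

Lemma runmax_homo s t : s \in `[0, T] -> t \in `[0, T] -> s <= t ->
  runmax s <= runmax t.
Proof.
move=> sT tT st; apply: runmax_le => //; first exact: runmax_ge0.
by move=> r rT rs; apply: runmax_ge => //; exact: le_trans st.
Qed.

Lemma runmax_frozen : frozen T runmax.
Proof. by move=> t; rewrite /runmax (clampE (clamp_itv t T0)). Qed.

Lemma clamp_homo s t : s <= t -> clamp T s <= clamp T t.
Proof.
move=> st; rewrite /clamp le_min ge_min ge_min lexx orbT andbT.
by rewrite ge_max !le_max lexx st orbT.
Qed.

Lemma runmax_nd : nondecreasing runmax.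
Proof.
move=> s t st; rewrite runmax_frozen [leRHS]runmax_frozen.
by apply: runmax_homo; rewrite ?clamp_itv//; exact: clamp_homo.
Qed.

Let zero_itv : 0 \in `[0, T]. Proof. by rewrite in_itv/= lexx. Qed.

Lemma runmax0 : runmax 0 = 0.
Proof.
apply/eqP; rewrite eq_le runmax_ge0// andbT; apply: runmax_le => // s sT s0.
suff -> : s = 0 by [].
by apply/eqP; rewrite eq_le s0/=; move: sT; rewrite in_itv/= => /andP[].
Qed.

Lemma runmax_itv_ucont : itv_ucont T runmax.
Proof.
move=> e e0; have [d d0 dP] := ua e0; exists d => //.
have main s t : s \in `[0, T] -> t \in `[0, T] -> s <= t -> `|s - t| < d ->
    runmax t <= runmax s + e.
  move=> sT tT st std; apply: runmax_le => //.
    by rewrite addr_ge0 ?(ltW e0) ?runmax_ge0.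
  move=> r rT rt; have [rs|sr] := leP r s.
    by rewrite ler_wpDr ?(ltW e0)// runmax_ge.
  have rsd : `|r - s| < d.
    rewrite (le_lt_trans _ std)// gtr0_norm ?subr_gt0// ler0_norm ?subr_le0//.
    by rewrite opprB lerD2r.
  have := dP _ _ rT sT rsd; have := runmax_ge sT sT (lexx _).
  by rewrite ler_norml; lra.
move=> s t sT tT std; have [st|ts] := leP s t.
  have := main _ _ sT tT st std; have := runmax_homo sT tT st.
  by rewrite ler_norml; lra.
rewrite distrC in std.
have := main _ _ tT sT (ltW ts) std; have := runmax_homo tT sT (ltW ts).
by rewrite ler_norml; lra.
Qed.

Lemma runmax_continuous : continuous runmax.
Proof.
have -> : runmax = (fun t => runmax (clamp T t)).
  by apply/funext => t; exact: runmax_frozen.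
exact: itv_ucont_continuous runmax_itv_ucont.
Qed.

Definition running_max : incr_fun T :=
  IncrFun runmax_continuous runmax_frozen runmax_nd runmax0.

(** Near [t] the obstacle stays below [a t + e], the midpoint between [a t] and [runmax t]. Those
    times therefore contribute nothing to the maximum, which must already be attained earlier. *)
Lemma runmax_flat t : t \in `[0, T] -> a t < runmax t ->
  exists2 d, 0 < d & forall s, s \in `[0, T] -> `|s - t| < d ->
    runmax s = runmax t.
Proof.
move=> tT aA; pose e := (runmax t - a t) / 2.
have e0 : 0 < e by rewrite divr_gt0// subr_gt0.
have [d d0 dP] := ua e0; exists d => // s sT std.
have near_t r : r \in `[0, T] -> `|r - t| < d -> a r <= a t + e.
  by move=> rT rt; have := dP _ _ rT tT rt; rewrite ler_norml; lra.
have ee : a t + e < runmax t by rewrite /e; lra.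
apply/eqP; rewrite eq_le; apply/andP; have [st|ts] := leP s t.
  split; first exact: runmax_homo.
  rewrite leNgt; apply/negP => sA; suff : runmax t < runmax t by rewrite ltxx.
  rewrite {1}(@le_lt_trans _ _ (Num.max (runmax s) (a t + e)))//; last first.
    by rewrite gt_max sA.
  apply: runmax_le => //; first by rewrite le_max runmax_ge0.
  move=> r rT rt; have [rs|sr] := leP r s; rewrite le_max.
    by rewrite runmax_ge.
  apply/orP; right; apply: near_t => //; rewrite (le_lt_trans _ std)//.
  by rewrite !ler0_norm ?subr_le0// lerN2 lerD2r ltW.
split; last by apply: runmax_homo => //; exact: ltW.
apply: runmax_le => //; first exact: runmax_ge0.
move=> r rT rs; have [rt|tr] := leP r t; first exact: runmax_ge.
rewrite (le_trans (near_t _ rT _)) ?(ltW ee)// (le_lt_trans _ std)//.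
by rewrite !gtr0_norm ?subr_gt0// lerD2r.
Qed.

End running_maximum.

(** * The Stieltjes measure of a nondecreasing function *)

Section stieltjes.
Context {R : realType} {T : R}.
Hypothesis T0 : 0 <= T.
Implicit Type A : incr_fun T.

Local Notation mu A := (lebesgue_stieltjes_measure (A : cumulative R R)).

Lemma stieltjes_itvoc A (a b : R) : a <= b ->
  mu A `]a, b]%classic = (A b - A a)%:E.
Proof.
move=> ab; rewrite /lebesgue_stieltjes_measure/= /measure_extension/=.
by rewrite measurable_mu_extE/= ?wlength_itv_bnd//; exact: is_ocitv.
Qed.

(** The rational intervals []q1, q2]] with [A q1 = A q2] are countably many null sets, and each
    point around which [A] is constant lies in one of them. The endpoints may leave [[0, T]], where
    [A] is frozen. *)
Lemma flat_null A (D : set R) :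
  (forall t, D t -> t \in `[0, T] /\ exists2 d, 0 < d &
     forall s, s \in `[0, T] -> `|s - t| < d -> A s = A t) ->
  exists N : set R, [/\ measurable N, mu A N = 0%E & D `<=` N].
Proof.
move=> DA.
pose I (q : rat * rat) : set R :=
  if (ratr q.1 <= ratr q.2 :> R) && (A (ratr q.1) == A (ratr q.2))
  then `]ratr q.1, ratr q.2]%classic else set0.
pose J n : set R := if unpickle n is Some q then I q else set0.
have mI q : measurable (I q).
  by rewrite /I; case: ifP => _; [exact: measurable_itv|exact: measurable0].
have I0 q : mu A (I q) = 0%E.
  rewrite /I; case: ifP => [/andP[q12 /eqP Aq]|_]; last exact: measure0.
  by rewrite stieltjes_itvoc// Aq subrr.
have mJ n : measurable (J n).
  by rewrite /J; case: unpickle => [q|]; [exact: mI|exact: measurable0].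
have J0 n : mu A (J n) = 0%E.
  by rewrite /J; case: unpickle => [q|]; [exact: I0|exact: measure0].
have mU : measurable (\bigcup_n J n) by apply: bigcup_measurable => n _; exact: mJ.
exists (\bigcup_n J n); split => //.
  apply/measure_negligible => //; apply: negligible_bigcup => n.
  by exists (J n); split; [exact: mJ|exact: J0|].
move=> t /DA[tT [d d0 dA]].
have [|q1] := @rat_in_itvoo R (t - d) t; first by lra.
rewrite in_itv/= => /andP[q1d q1t].
have [|q2] := @rat_in_itvoo R t (t + d); first by lra.
rewrite in_itv/= => /andP[q2t q2d].
have Aq q : `|ratr q - t| < d -> A (ratr q) = A t.
  move=> qt; rewrite (incr_fun_frozen A); apply: dA; first exact: clamp_itv.
  by rewrite -[t in X in X < _](clampE tT) (le_lt_trans (clamp_lip _ _ _)).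
exists (pickle (q1, q2)); first exact: Logic.I.
rewrite /J pickleK /I /fst /snd.
rewrite !Aq ?eqxx ?andbT; last 2 first.
- by rewrite ltr_norml; lra.
- by rewrite ltr_norml; lra.
rewrite (ltW (lt_trans q1t q2t)) /= in_itv/= q1t/=.
exact: ltW.
Qed.

Lemma stieltjes_integral_eq0 A (D N : set R) (f : R -> \bar R) :
  measurable N -> mu A N = 0%E -> (forall t, D t -> ~ N t -> f t = 0%E) ->
  (\int[mu A]_(t in D) f t = 0)%E.
Proof.
move=> mN N0 f0; rewrite integral_mkcond.
rewrite (@null_eq_integral _ _ _ (mu A) N _ (cst 0%E) mN N0) ?integral0// => t Nt.
by rewrite patchE; case: ifPn => // /set_mem Dt; exact: f0.
Qed.

(** Markov's inequality: [c * (A b - A a)] is at most the integral. *)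
Lemma stieltjes_integral_eq0_flat A (f : R -> \bar R) (a b c : R) :
  0 <= a -> a <= b -> b <= T -> 0 < c ->
  (forall t, t \in `[0, T] -> (0 <= f t)%E) ->
  (forall t, a < t <= b -> (c%:E <= f t)%E) ->
  (\int[mu A]_(t in `[0%R, T]) f t = 0)%E -> A b = A a.
Proof.
move=> a0 ab bT c0 f0 fc If.
have : (\int[mu A]_(t in `]a, b]) c%:E <= 0)%E.
  rewrite -[leRHS]If integral_mkcond [leRHS]integral_mkcond.
  apply: (ge0_null_le_integral (N := set0)) => //.
  - by move=> t; rewrite patchE; case: ifP => // _; rewrite lee_fin ltW.
  - by move=> t; rewrite patchE; case: ifPn => // /set_mem; exact: f0.
  move=> t _; rewrite !patchE; case: ifPn => [/set_mem|_]; last first.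
    by case: ifPn => // /set_mem; exact: f0.
  rewrite /= in_itv/= => /andP[aT tb].
  by rewrite mem_set ?fc ?aT//= in_itv/= (ltW (le_lt_trans a0 aT)) (le_trans tb).
have mab := stieltjes_itvoc A ab.
rewrite integral_cst//= [X in (_ * X)%E]mab -EFinM lee_fin pmulr_rle0// => Aab.
apply/eqP; rewrite eq_le -subr_le0 Aab/=; exact: (@incr_fun_nd _ _ A).
Qed.

End stieltjes.

(** * Zero of an increasing bi-Lipschitz function *)

Section bilipschitz_root.
Context {R : realType}.

Lemma bilipschitz_root (f : R -> R) (c C : R) : 0 < c ->
  (forall x y, y <= x -> c * (x - y) <= f x - f y <= C * (x - y)) ->
  exists a, f a = 0.
Proof.
move=> c0 fcC.
have cf : continuous f.
  move=> x; apply/cvgrPdist_le => e e0; have K0 : 0 < `|C| + 1 by rewrite ltr_wpDl.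
  have d0 : 0 < e / (`|C| + 1) by rewrite divr_gt0.
  near=> y; rewrite (@le_trans _ _ ((`|C| + 1) * `|x - y|))//.
    have main u v : v <= u -> `|f u - f v| <= (`|C| + 1) * `|u - v|.
      move=> vu; have /andP[h1 h2] := fcC _ _ vu.
      have uv : 0 <= u - v by rewrite subr_ge0.
      rewrite ger0_norm; last by rewrite (le_trans _ h1)// mulr_ge0// ltW.
      rewrite (ger0_norm uv) (le_trans h2)// ler_wpM2r//.
      by rewrite ler_wpDr// ler_norm.
    have [yx|xy] := leP y x; first exact: main.
    by rewrite distrC [`|x - y|]distrC main// ltW.
  rewrite mulrC -ler_pdivlMr// ltW//.
(* Growth at rate at least [c] over a length [r] compensates [f 0], so [f] changes sign on
   [[- r, r]]. *)
pose r := `|f 0| / c; have r0 : 0 <= r by rewrite divr_ge0// ltW.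
have crE : c * r = `|f 0| by rewrite /r mulrC divfK// gt_eqF.
have /andP[h1 _] := fcC r 0 r0.
have /andP[h2 _] := fcC 0 (- r) (ltac:(by rewrite oppr_le0)).
have f0 := ler_norm (f 0); have := ler_norm (- f 0); rewrite normrN => f0'.
have fr : 0 <= f r by move: h1; rewrite subr0 crE; lra.
have fNr : f (- r) <= 0 by move: h2; rewrite sub0r opprK crE; lra.
have [||a _ fa] := @IVT R f (- r) r 0 _ (continuous_subspaceT cf).
- by lra.
- by rewrite ge_min fNr/= le_max fr orbT.
by exists a.
Unshelve. all: by end_near. Qed.

End bilipschitz_root.

(** * The loss function and the mean loss *)

Section loss_function.
Context {R : realType} {T : R}.
Variable calP : set (probability (cpath T) R).
Hypothesis T0 : 0 <= T.
Hypothesis calP0 : calP !=set0.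
Variables (l : cpath T -> R -> R -> R) (c C kappa : R).
Hypothesis c0 : 0 < c.
Hypothesis cC : c < C.
Hypothesis l_ucont : forall e : R, 0 < e -> exists2 d : R, 0 < d &
  forall w (t s x y : R), t \in `[0, T] -> s \in `[0, T] ->
    `|t - s| < d -> `|x - y| < d -> `|l w t x - l w s y| < e.
Hypothesis l_incr : forall t : R, t \in `[0, T] ->
  qs calP (fun w => forall x y, x < y -> l w t x < l w t y).
Hypothesis l_meas : forall t x : R, t \in `[0, T] ->
  qs_measurable_real calP (fun w => l w t x).
Hypothesis l_growth : forall t x : R, t \in `[0, T] ->
  qs calP (fun w => `|l w t x| <= kappa * (1 + `|x|)).
Hypothesis l_lip : forall t x y : R, t \in `[0, T] ->
  qs calP (fun w => c * `|x - y| <= `|l w t x - l w t y| /\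
                    `|l w t x - l w t y| <= C * `|x - y|).

Let C0 : 0 < C. Proof. exact: lt_trans cC. Qed.

Lemma rat_approx (x d : R) : 0 < d -> exists q : rat, `|x - ratr q| < d.
Proof.
move=> d0; have [|q] := @rat_in_itvoo R (x - d) (x + d); first by lra.
by rewrite in_itv/= => /andP[q1 q2]; exists q; rewrite ltr_norml; lra.
Qed.

(** The exceptional sets of the rational pairs are joined, and the uniform continuity of [l] extends
    the bounds to real pairs; monotonicity removes the absolute values. With one exceptional set for
    all [x] and [y], the bounds apply at random arguments such as [S t w + x]. *)
Lemma loss_bilipschitz t : t \in `[0, T] -> qs calP (fun w => forall x y, y <= x ->
  c * (x - y) <= l w t x - l w t y <= C * (x - y)).
Proof.
move=> tT.
have lq : qs calP (fun w => forall q : rat * rat,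
    c * `|ratr q.1 - ratr q.2| <= `|l w t (ratr q.1) - l w t (ratr q.2)| /\
    `|l w t (ratr q.1) - l w t (ratr q.2)| <= C * `|ratr q.1 - ratr q.2|).
  by apply: qs_forall => // q; exact: l_lip.
apply: qsW (qs_and calP0 lq (l_incr tT)) => w [{}lq li] x y yx.
have lxy : 0 <= l w t x - l w t y.
  rewrite subr_ge0; move: yx; rewrite le_eqVlt => /predU1P[->//|/li].
  exact: ltW.
have xy0 : 0 <= x - y by rewrite subr_ge0.
have K0 : 0 < 2 + 2 * C by move: C0; lra.
have approx e : 0 < e -> exists u v : R, [/\ c * u <= v <= C * u,
    `|u - (x - y)| <= 2 * e & `|v - (l w t x - l w t y)| <= 2 * e].
  move=> e0; have [d d0 dP] := l_ucont e0.
  have m0 : 0 < Num.min d e by rewrite lt_min d0.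
  have [q1 xq] := rat_approx x m0; have [q2 yq] := rat_approx y m0.
  move: xq yq; rewrite !lt_min => /andP[xd xe] /andP[yd ye].
  have t0 : `|t - t| < d by rewrite subrr normr0.
  have lxq := dP w _ _ _ _ tT tT t0 xd; have lyq := dP w _ _ _ _ tT tT t0 yd.
  have [h1 h2] := lq (q1, q2); move: h1 h2 => /= h1 h2.
  exists `|ratr q1 - ratr q2|, `|l w t (ratr q1) - l w t (ratr q2)|.
  split; first by rewrite h1.
  - rewrite -(ger0_norm xy0) (le_trans (ler_dist_dist _ _))//.
    by move: xe ye; rewrite !ltr_norml ler_norml; lra.
  - rewrite -(ger0_norm lxy) (le_trans (ler_dist_dist _ _))//.
    by move: lxq lyq; rewrite !ltr_norml ler_norml; lra.
apply/andP; split; apply/ler_addgt0Pr => e e0.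
  (* Errors of [2 * d] in both [u] and [v], where [d] is this quotient, cost at most
     [(2 + 2 * C) * d = e], as [c <= C]. *)
  have e'0 : 0 < e / (2 + 2 * C) by rewrite divr_gt0.
  have eE : (2 + 2 * C) * (e / (2 + 2 * C)) = e by rewrite mulrC divfK// gt_eqF.
  have [u [v [/andP[cu uC]]]] := approx _ e'0; move: eE; move: (e / _) e'0 => d d0 eE.
  rewrite !ler_norml => /andP[u1 u2] /andP[v1 v2].
  have cd : c * d <= C * d by rewrite ler_wpM2r// ltW.
  have : c * (x - y) <= c * (u + 2 * d) by rewrite ler_wpM2l ?(ltW c0)//; lra.
  by move: eE; lra.
have e'0 : 0 < e / (2 + 2 * C) by rewrite divr_gt0.
have eE : (2 + 2 * C) * (e / (2 + 2 * C)) = e by rewrite mulrC divfK// gt_eqF.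
have [u [v [/andP[cu uC]]]] := approx _ e'0; move: eE; move: (e / _) e'0 => d d0 eE.
rewrite !ler_norml => /andP[u1 u2] /andP[v1 v2].
have : C * u <= C * (x - y + 2 * d) by rewrite ler_wpM2l ?(ltW C0)//; lra.
by move: eE; lra.
Qed.

(** Since [l w t] is increasing and continuous, [l w t (g w)] is the supremum of [l w t q] over the
    rationals [q < g w]; in [u], the other rationals receive the neutral value [-oo]. *)
Lemma loss_measurable t (X : cpath T -> R) : t \in `[0, T] ->
  qs_measurable_real calP X -> qs_measurable_real calP (fun w => l w t (X w)).
Proof.
move=> tT [g mg Xg]; apply/qs_measurableP.
pose q n : R := ratr (odflt 0 (unpickle n : option rat)).
have /choice[h_ hP] n : exists h : cpath T -> R, measurable_fun setT h /\
    qs calP (fun w => l w t (q n) = h w).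
  by have [h mh lh] := l_meas (q n) tT; exists h.
pose u n w : \bar R := if q n < g w then (h_ n w)%:E else -oo%E.
exists (fun w => esups (u ^~ w) 0%N).
  apply: measurable_fun_esups => n; apply: measurable_fun_ifT => //.
    exact: measurable_fun_ltr.
  by apply/measurable_EFinP; have [] := hP n.
have lh : qs calP (fun w => forall n, l w t (q n) = h_ n w).
  by apply: qs_forall_nat => // n; have [] := hP n.
apply: qsW (qs_and calP0 (qs_and calP0 Xg lh) (l_incr tT)) => w [[Xw {}lh] li].
rewrite /= Xw; apply/eqP; rewrite eq_le; apply/andP; split; last first.
  apply: esups0_le => n; rewrite /u; case: ifPn => [qg|_]; last exact: leNye.
  by rewrite -lh lee_fin ltW// li.
apply/lee_addgt0Pr => e e0; have [d d0 dP] := l_ucont e0.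
have [|r] := @rat_in_itvoo R (g w - d) (g w); first by lra.
rewrite in_itv/= => /andP[r1 r2].
have qr : q (pickle r) = ratr r by rewrite /q pickleK.
rewrite (le_trans _ (leeD2r _ (esups0_ub _ (pickle r))))// /u qr r2 -lh qr.
rewrite -EFinD lee_fin.
have : `|l w t (g w) - l w t (ratr r)| < e.
  by apply: dP; rewrite ?subrr ?normr0// ltr_norml; lra.
by rewrite ltr_norml; lra.
Qed.

Lemma loss_upper_integrable t (X : cpath T -> R) : t \in `[0, T] ->
  upper_integrable calP X -> upper_integrable calP (fun w => l w t (X w)).
Proof.
move=> tT uX.
have uB : upper_integrable calP (fun w => kappa * (1 + `|0 : R|) + C * `|X w|).
  apply: upper_integrableD => //; first exact: upper_integrable_cst.
  by apply: upper_integrableZ => //; exact: upper_integrable_norm.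
apply: (upper_integrable_le calP0 _ uB).
  by apply: loss_measurable => //; have [] := uX.
apply: qsW (qs_and calP0 (l_growth 0 tT) (loss_bilipschitz tT)) => w [l0 lC].
move: l0; rewrite -[X w]addr0; move: (X w) => x; rewrite addr0 => l0.
have : `|l w t x - l w t 0| <= C * `|x|.
  have [x0|x0] := leP 0 x.
    have /andP[h1 h2] := lC _ _ x0; rewrite ger0_norm ?(ger0_norm x0).
      by rewrite subr0 in h2.
    by rewrite (le_trans _ h1)// mulr_ge0 ?(ltW c0)// subr0.
  have /andP[h1 h2] := lC _ _ (ltW x0); rewrite distrC ger0_norm.
    by rewrite ltr0_norm//; rewrite sub0r in h2.
  by rewrite (le_trans _ h1)// mulr_ge0 ?(ltW c0)// sub0r oppr_ge0 ltW.
have := ler_normD (l w t x - l w t 0) (l w t 0); rewrite subrK; lra.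
Qed.

Variables (p : R) (S : R -> cpath T -> R).
Hypothesis p1 : 1 <= p.
Hypothesis SGS : SG calP p S.
Hypothesis wc : weakly_compact calP.

Definition mean_loss (t x : R) : R := Eup calP (fun w => l w t (S t w + x)).

Lemma shifted_loss_upper_integrable t x : t \in `[0, T] ->
  upper_integrable calP (fun w => l w t (S t w + x)).
Proof.
move=> tT; apply: loss_upper_integrable => //; apply: upper_integrableD => //.
  exact: SG_upper_integrable SGS tT.
exact: upper_integrable_cst.
Qed.

Lemma Ehat_mean_loss t x : t \in `[0, T] ->
  Ehat calP (fun w => (l w t (S t w + x))%:E) = (mean_loss t x)%:E.
Proof. by move=> tT; apply: EupE => //; exact: shifted_loss_upper_integrable. Qed.

(** The increments of the loss lie q.s. between two constants, and constants pass through the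
    sublinear expectation. *)
Lemma mean_loss_bilipschitz t x y : t \in `[0, T] -> y <= x ->
  c * (x - y) <= mean_loss t x - mean_loss t y <= C * (x - y).
Proof.
move=> tT yx; have ux := shifted_loss_upper_integrable x tT.
have uy := shifted_loss_upper_integrable y tT.
have uK (K : R) := upper_integrable_cst calP0 K.
apply/andP; split; last first.
  rewrite lerBlDr addrC -[X in _ + X](Eup_cst calP0 (C * (x - y))).
  apply: Eup_le_add => //; apply: qsW (loss_bilipschitz tT) => w lC.
  have /andP[_] := lC (S t w + x) (S t w + y) (ltac:(by rewrite lerD2l)).
  by rewrite (_ : S t w + x - (S t w + y) = x - y); lra.
have : mean_loss t y <= mean_loss t x + - (c * (x - y)).
  rewrite -[X in _ + X](Eup_cst calP0 (- (c * (x - y)))).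
  apply: Eup_le_add => //; apply: qsW (loss_bilipschitz tT) => w lC.
  have /andP[+ _] := lC (S t w + x) (S t w + y) (ltac:(by rewrite lerD2l)).
  by rewrite (_ : S t w + x - (S t w + y) = x - y); lra.
lra.
Qed.

(** Changing the time in [l] at a fixed argument costs [e / 2]; replacing [S s] by [S t] costs [C]
    times the mean of [|S s - S t|]. Neither bound depends on [x]. *)
Lemma mean_loss_ucont e : 0 < e -> exists2 d, 0 < d &
  forall s t x, s \in `[0, T] -> t \in `[0, T] -> `|s - t| < d ->
    `|mean_loss s x - mean_loss t x| <= e.
Proof.
move=> e0; have e20 : 0 < e / 2 by rewrite divr_gt0.
have eC0 : 0 < e / 2 / C by rewrite divr_gt0.
have [d1 d10 d1P] := l_ucont e20.
have [d2 d20 d2P] := SG_Eup_ucont p1 T0 calP0 wc SGS eC0.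
have main s t x : s \in `[0, T] -> t \in `[0, T] -> `|s - t| < Num.min d1 d2 ->
    mean_loss s x <= mean_loss t x + e.
  move=> sT tT; rewrite lt_min => /andP[st1 st2].
  have uS : upper_integrable calP (fun w => `|S s w - S t w|).
    apply: upper_integrable_norm => //; apply: upper_integrableB => //.
      exact: SG_upper_integrable SGS sT.
    exact: SG_upper_integrable SGS tT.
  have uB : upper_integrable calP (fun w => C * `|S s w - S t w| + e / 2).
    apply: upper_integrableD => //; first exact: upper_integrableZ.
    exact: upper_integrable_cst.
  apply: (@le_trans _ _ (mean_loss t x +
      Eup calP (fun w => C * `|S s w - S t w| + e / 2))).
    apply: Eup_le_add => //; [exact: shifted_loss_upper_integrable..|].
    apply: qsW (loss_bilipschitz tT) => w lC.
    have : `|l w s (S s w + x) - l w t (S s w + x)| < e / 2.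
      by apply: d1P => //; rewrite subrr normr0.
    have : l w t (S s w + x) - l w t (S t w + x) <= C * `|S s w - S t w|.
      have [ts|st] := leP (S t w) (S s w).
        have /andP[_] := lC (S s w + x) (S t w + x) (ltac:(by rewrite lerD2r)).
        rewrite (_ : S s w + x - (S t w + x) = S s w - S t w); last by lra.
        by rewrite ger0_norm// subr_ge0.
      have /andP[h _] := lC (S t w + x) (S s w + x) (ltac:(by rewrite lerD2r ltW)).
      have : 0 <= c * (S t w + x - (S s w + x)).
        by rewrite mulr_ge0 ?(ltW c0)// subr_ge0 lerD2r ltW.
      have : 0 <= C * `|S s w - S t w| by rewrite mulr_ge0// ltW.
      by lra.
    by rewrite ltr_norml; lra.
  rewrite lerD2l.
  rewrite [leRHS](_ : e = C * (e / 2 / C) + e / 2); last first.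
    by rewrite mulrC divfK ?gt_eqF//; lra.
  apply: (ge0_Eup_le_affine calP0 (g := fun w => (`|S s w - S t w|)%:E)) => //.
  - exact: ltW.
  - exact: ltW.
  - by move=> w; rewrite addr_ge0 ?mulr_ge0// ltW.
  - by apply/qs_measurableP; have [] := uS.
  - by rewrite EupE// lee_fin d2P.
  - by apply: qsT => // w; rewrite EFinD EFinM.
exists (Num.min d1 d2); first by rewrite lt_min d10.
move=> s t x sT tT st; have := main _ _ x sT tT st.
rewrite distrC in st; have := main _ _ x tT sT st.
by rewrite ler_norml; lra.
Qed.

(** Uniform continuity of [a] follows from the lower Lipschitz bound: [c * |a s - a t|] is at most
    [|mean_loss s (a t)|], which equals [|mean_loss s (a t) - mean_loss t (a t)|]. *)
Lemma mean_loss_root : exists a : R -> R, itv_ucont T a /\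
  forall t, t \in `[0, T] -> mean_loss t (a t) = 0.
Proof.
have /choice[a aP] t : exists a, t \in `[0, T] -> mean_loss t a = 0.
  have [tT|tT] := boolP (t \in `[0, T]); last by exists 0.
  have [a fa] := bilipschitz_root c0 (fun x y yx => mean_loss_bilipschitz tT yx).
  by exists a.
exists a; split=> // e e0.
have [d d0 dP] := mean_loss_ucont (mulr_gt0 c0 e0).
exists d => // s t sT tT st.
have := dP s t (a t) sT tT st; rewrite (aP t tT) subr0 => le_ce.
rewrite -(ler_pM2l c0); apply: le_trans le_ce; have [ats|ast] := leP (a t) (a s).
  have /andP[h _] := mean_loss_bilipschitz sT ats.
  rewrite ger0_norm ?subr_ge0//; move: h; rewrite (aP s sT) sub0r => /le_trans.
  by apply; rewrite -normrN ler_norm.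
have /andP[h _] := mean_loss_bilipschitz sT (ltW ast).
rewrite distrC ger0_norm ?subr_ge0 ?(ltW ast)//; move: h; rewrite (aP s sT) subr0.
by move=> /le_trans; apply; rewrite ler_norm.
Qed.

End loss_function.

Theorem theorem3p6 (R : realType) (T sigl sigu : R) (hT : 0 < T)
    (hsigl : 0 < sigl ^+ 2) (hsig : sigl ^+ 2 < sigu ^+ 2)
    (calP : set (probability (cpath T) R))
    (hcalP : G_representing sigl sigu calP)
    (l : cpath T -> R -> R -> R) (S : R -> cpath T -> R) (p : R)
    (hl : Hl calP l) (hS : HS calP l p S)
    (F : R -> R) (c_l C_l : R)
    (hF : {in `[0, +oo[ &, nondecreasing F})
    (hFc : {within `[0, +oo[, continuous F})
    (hFge0 : forall r : R, 0 <= r -> 0 <= F r) (hF0 : F 0 = 0)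
    (hc : 0 < c_l) (hcC : c_l < C_l)
    (hl_t : forall t s x : R, t \in `[0, T] -> s \in `[0, T] ->
       qs calP (fun w => `|l w t x - l w s x| <= F `|t - s|))
    (hl_x : forall t x y : R, t \in `[0, T] ->
       qs calP (fun w => c_l * `|x - y| <= `|l w t x - l w t y| /\
                         `|l w t x - l w t y| <= C_l * `|x - y|)) :
  exists (X : R -> cpath T -> R) (A : incr_fun T),
    SP_solution calP l p S X A /\
    forall (X' : R -> cpath T -> R) (A' : incr_fun T),
      SP_solution calP l p S X' A' ->
      qs calP (fun w => forall t : R, t \in `[0, T] -> X' t w = X t w) /\
      (forall t : R, t \in `[0, T] -> A' t = A t).
Proof.
have T0 : 0 <= T := ltW hT.
have [wc _] := hcalP; have [l_ucont l_incr l_LG [kappa _ l_growth]] := hl.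
have [p1 SGS ES0] := hS.
(* For empty [calP] the upper expectation would be [-oo], against the condition on [l(0, S_0)]. *)
have calP0 : calP !=set0.
  apply/set0P/eqP => calPE; move: ES0.
  by rewrite /Ehat calPE image_set0 ereal_sup0 leNgt ltNyr.
have l_meas t x : t \in `[0, T] -> qs_measurable_real calP (fun w => l w t x).
  by move=> /l_LG[/(_ x)[+ _] _] => /qs_measurableP.
have zT : 0 \in `[0, T] by rewrite in_itv/= lexx.
pose phi := mean_loss calP l S.
have EhatE t x : t \in `[0, T] ->
    Ehat calP (fun w => (l w t (S t w + x))%:E) = (phi t x)%:E.
  exact: (Ehat_mean_loss T0 calP0 hc hcC l_ucont l_incr l_meas l_growth
    hl_x p1 SGS).
have phi_bilip t x y : t \in `[0, T] -> y <= x ->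
    c_l * (x - y) <= phi t x - phi t y <= C_l * (x - y).
  exact: (mean_loss_bilipschitz T0 calP0 hc hcC l_ucont l_incr l_meas l_growth
    hl_x p1 SGS).
have [a [ua phia]] : exists a : R -> R, itv_ucont T a /\
    forall t, t \in `[0, T] -> phi t (a t) = 0.
  exact: (mean_loss_root T0 calP0 hc hcC l_ucont l_incr l_meas l_growth
    hl_x p1 SGS wc).
have phi_ge t x : t \in `[0, T] -> a t <= x -> c_l * (x - a t) <= phi t x.
  by move=> tT ax; have /andP[+ _] := phi_bilip t _ _ tT ax; rewrite phia// subr0.
(* The mean constraint becomes the obstacle condition [a t <= x]. *)
have phi_ge0 t x : t \in `[0, T] -> (0 <= phi t x) = (a t <= x).
  move=> tT; apply/idP/idP => [|ax]; last first.
    by rewrite (le_trans _ (phi_ge _ _ tT ax))// mulr_ge0 ?(ltW hc)// subr_ge0.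
  rewrite !leNgt; apply: contra => xa.
  have /andP[+ _] := phi_bilip t _ _ tT (ltW xa); rewrite phia// sub0r.
  have : 0 < c_l * (a t - x) by rewrite mulr_gt0// subr_gt0.
  by lra.
have a0 : a 0 <= 0.
  rewrite -phi_ge0// -lee_fin -EhatE//.
  by under [X in Ehat _ X]eq_fun do rewrite addr0.
pose A : incr_fun T := running_max T0 ua a0.
have A_ge t : t \in `[0, T] -> a t <= A t.
  by move=> tT; exact: (runmax_ge T0 ua).
exists (fun t w => S t w + A t), A; split.
  split.
  - exact: SG_add_incr_fun.
  - by move=> t tT; exact: qsT.
  - by move=> t tT; rewrite EhatE// lee_fin phi_ge0// A_ge.
  (* Outside a null set for [dA], [A t = a t] and the mean loss vanishes. *)
  have [|N [mN N0 DN]] := @flat_null R T T0 A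
      [set t | t \in `[0, T] /\ a t < A t].
    by move=> t [tT aA]; split=> //; exact: (runmax_flat T0 ua).
  apply: (stieltjes_integral_eq0 mN N0) => t tT Nt; rewrite EhatE//.
  congr EFin; rewrite -(phia t)//; congr phi; apply/eqP.
  rewrite eq_le A_ge// andbT leNgt; apply/negP => aA.
  by apply: Nt; exact: DN.
move=> X' A' [SGX' X'E X'ge0 IX'].
have X'phi t : t \in `[0, T] ->
    Ehat calP (fun w => (l w t (X' t w))%:E) = (phi t (A' t))%:E.
  move=> tT; rewrite -EhatE//; apply: qs_eq_Ehat => //.
  by apply: qsW (X'E t tT) => w ->.
have A'_ge t : t \in `[0, T] -> a t <= A' t.
  by move=> tT; rewrite -phi_ge0// -lee_fin -X'phi// X'ge0.
(* Minimality: a solution is nondecreasing, nonnegative and above the obstacle, hence above the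
   running maximum. *)
have A_le t : t \in `[0, T] -> A t <= A' t.
  move=> tT; apply: runmax_le => //.
    rewrite -(incr_fun0 A'); apply: (@incr_fun_nd _ _ A').
    by move: tT; rewrite in_itv/= => /andP[].
  move=> s sT st; rewrite (le_trans (A'_ge _ sT))//.
  exact: (@incr_fun_nd _ _ A').
have A'E t : t \in `[0, T] -> A' t = A t.
  move=> tT; apply/eqP; rewrite eq_le A_le// andbT leNgt; apply/negP => AA'.
  pose g s := A' s - A s; pose D := g t.
  have D0 : 0 < D by rewrite subr_gt0.
  have /andP[t0 tleT] : 0 <= t <= T by move: tT; rewrite in_itv.
  (* After [r = sup E] the gap [g], hence the distance from [A'] to the obstacle, exceeds [D / 2],
     so the mean loss is at least [c_l * (D / 2)] and [A'] is constant on [[r, t]]. As [A] is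
     nondecreasing, [D = g t <= g r <= D / 2], a contradiction. *)
  pose E := [set s | 0 <= s <= t /\ g s <= D / 2].
  have E0 : E 0.
    by split; rewrite ?lexx// /g !incr_fun0 subrr divr_ge0// ltW.
  have ubE : ubound E t by move=> s [/andP[]].
  have hsE : has_sup E by split; [exists 0|exists t].
  pose r := sup E.
  have r0 : 0 <= r by apply: ub_le_sup => //; exists t.
  have rt : r <= t by apply: ge_sup => //; exists 0.
  have cg : continuous g.
    move=> s; apply: (@cvgB _ R^o); exact: incr_fun_continuous.
  have gr : g r <= D / 2.
    rewrite leNgt; apply/negP => Dg.
    have e0 : 0 < g r - D / 2 by rewrite subr_gt0.
    have /cvgrPdist_lt/(_ _ e0)/nbhs_ballP[d /= d0 dP] := cg r.
    have [s Es rs] := sup_adherent d0 hsE.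
    have sr : s <= r by apply: ub_le_sup => //; exists t.
    have := dP s; rewrite /ball/= ger0_norm ?subr_ge0// ltrBlDr => /(_ _).
    have [_ gs] := Es; have : r < d + s by move: rs; rewrite -/r; lra.
    by move=> h /(_ h); rewrite ltr_norml; lra.
  have rt' : r < t.
    rewrite lt_neqAle rt andbT; apply/eqP => rE; move: gr; rewrite rE -/D; lra.
  have A'flat : A' t = A' r.
    apply: (stieltjes_integral_eq0_flat (c := c_l * (D / 2)) r0 rt tleT _ _ _ IX').
    - by rewrite mulr_gt0// divr_gt0.
    - exact: X'ge0.
    move=> s /andP[rs st].
    have sT : s \in `[0, T].
      by rewrite in_itv/= (le_trans r0 (ltW rs)) (le_trans st).
    rewrite X'phi// lee_fin (le_trans _ (phi_ge _ _ sT (A'_ge _ sT)))//.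
    rewrite ler_wpM2l ?(ltW hc)//.
    have gs : D / 2 < g s.
      rewrite ltNge; apply/negP => gs; suff : s <= r by rewrite leNgt rs.
      apply: ub_le_sup; first by exists t.
      by split => //; rewrite st (le_trans r0 (ltW rs)).
    by have := A_ge s sT; move: gs; rewrite /g; lra.
  have : A r <= A t by exact: (@incr_fun_nd _ _ A).
  by move: gr D0; rewrite /D /g A'flat; lra.
split=> //.
(* The identity [X' = S + A] holds q.s. at each fixed time; it is collected over the dense times and
   extended to all times by continuity of the paths of both processes. *)
have X'X : qs calP (fun w => forall n, X' (dense_time T n) w =
    S (dense_time T n) w + A (dense_time T n)).
  apply: qs_forall_nat => // n; have nT := dense_time_itv n T0.
  by apply: qsW (X'E _ nT) => w ->; rewrite A'E.
have SGX := SG_add_incr_fun p1 T0 calP0 A SGS.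
apply: qsW (qs_and calP0 X'X (qs_and calP0 (SG_itv_ucont p1 T0 calP0 SGX')
  (SG_itv_ucont p1 T0 calP0 SGX))) => w [X'Xw [uX' uX]] t tT.
apply/eqP; rewrite eq_le -subr_le0 -[X in _ && X]subr_le0; apply/andP; split.
  apply: (itv_ucont_dense_le T0 (itv_ucontD uX' (itv_ucontN uX))) => // n.
  by rewrite X'Xw subrr.
apply: (itv_ucont_dense_le T0 (itv_ucontD uX (itv_ucontN uX'))) => // n.
by rewrite X'Xw subrr.
Qed.
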